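(* Let $p$ be a density function on $[0,1]$ and let $\alpha\in(0,\pi]$, $\beta\in[0,\pi)$. The lowest eigenvalue $\lambda_0(p,\alpha,\beta)$ of the operator $S(p,\alpha,\beta)$ satisfies: (i) $\lambda_0(p,\alpha,\beta)=0$ if $(\alpha,\beta)\in[\pi/4,\pi]\times[0,3\pi/4]$ and $\cos\alpha\cos\beta-\sin(\alpha-\beta)=0$; (ii) $\lambda_0(p,\alpha,\beta)>0$ if $(\alpha,\beta)\in(\pi/4,\pi]\times[0,3\pi/4)$ and $\cos\alpha\cos\beta-\sin(\alpha-\beta)<0$; (iii) $\lambda_0(p,\alpha,\beta)<0$ for all other $(\alpha,\beta)\in(0,\pi]\times[0,\pi)$.
   Context: A density function is a real-valued, piecewise continuous, positive function on $[0,1]$ that is bounded away from $0$. For a density function $p$ and $\alpha\in(0,\pi]$, $\beta\in[0,\pi)$, $S(p,\alpha,\beta)$ denotes the self-adjoint operator generated by the boundary value problem (vibrating string equation) $$-u'' = \lambda p(x) u,\quad x\in(0,1),\ \lambda\in\mathbb{C},$$ $$u(0)\cos\alpha + u'(0)\sin\alpha = 0,\qquad u(1)\cos\beta + u'(1)\sin\beta = 0.$$ Its spectrum is discrete and consists of real, simple eigenvalues, denoted $\lambda_0(p,\alpha,\beta) < \lambda_1(p,\alpha,\beta) < \cdots < \lambda_n(p,\alpha,\beta) < \cdots$. *)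

(* Defs.v *)
From HB Require Import structures.
From mathcomp Require Import all_boot all_order all_algebra.
From mathcomp Require Import complex.
From mathcomp Require Import all_classical all_reals all_analysis.

Set Implicit Arguments.
Unset Strict Implicit.
Unset Printing Implicit Defensive.

Import Order.TTheory GRing.Theory Num.Theory.
Import numFieldNormedType.Exports.

Local Open Scope classical_set_scope.
Local Open Scope ring_scope.

(* Functions on [0,1] are represented by total functions on R; nothing below
   depends on their values outside [0,1]. *)

(* Finitely many discontinuities, all of them with finite one-sided limits. *)
Definition piecewise_continuous (R : realType) (p : R -> R) : Prop :=
  [/\ exists s : seq R,
        forall x, x \in `]0, 1[ -> x \notin s -> {for x, continuous p},
      forall x, x \in `[0, 1[ -> cvg (p y @[y --> x^'+])
    & forall x, x \in `]0, 1] -> cvg (p y @[y --> x^'-])].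

Definition density (R : realType) (p : R -> R) : Prop :=
  [/\ piecewise_continuous p,
      forall x, x \in `[0, 1] -> 0 < p x
    & exists2 c : R, 0 < c & forall x, x \in `[0, 1] -> c <= p x].

(* F is absolutely continuous on [0,1] and F' = f almost everywhere, expressed
   by F being the indefinite Lebesgue integral of the integrable function f. *)
Definition primitive (R : realType) (F f : R -> R) : Prop :=
  (@lebesgue_measure R).-integrable `[0, 1] (EFin \o f) /\
  forall x, x \in `[0, 1] ->
    F x = F 0 + \int[@lebesgue_measure R]_(t in `[0, x]) f t.

Definition cprimitive (R : realType) (F f : R -> R[i]) : Prop :=
  primitive (fun x => complex.Re (F x)) (fun x => complex.Re (f x)) /\
  primitive (fun x => complex.Im (F x)) (fun x => complex.Im (f x)).

(* f belongs to the complex Hilbert space L^2([0,1]; p dx). *)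
Definition weighted_L2 (R : realType) (p : R -> R) (f : R -> R[i]) : Prop :=
  [/\ measurable_fun (`[0, 1] : set R) (fun x => complex.Re (f x)),
      measurable_fun (`[0, 1] : set R) (fun x => complex.Im (f x))
    & (@lebesgue_measure R).-integrable `[0, 1]
        (fun x => ((complex.Re (f x) ^+ 2 + complex.Im (f x) ^+ 2) * p x)%:E)].

(* Graph of S(p, alpha, beta), acting in L^2([0,1]; p dx) by u |-> - u'' / p:
   u is in the domain (u and u' = v absolutely continuous, u'' = w, boundary
   conditions) and S u = f. The functions u and v are the continuous
   representatives, so that their boundary values are meaningful. *)
Definition string_operator (R : realType) (p : R -> R) (alpha beta : R)
    (u f : R -> R[i]) : Prop :=
  weighted_L2 p u /\ weighted_L2 p f /\
  exists v w : R -> R[i],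
    [/\ cprimitive u v,
        cprimitive v w,
        {ae @lebesgue_measure R, forall x, x \in `[0, 1] ->
          - w x = (p x)%:C%C * f x},
        u 0 * (cos alpha)%:C%C + v 0 * (sin alpha)%:C%C = 0
      & u 1 * (cos beta)%:C%C + v 1 * (sin beta)%:C%C = 0].

(* As u is continuous on [0,1], it is nonzero in L^2 iff it is nonzero at some
   point. *)
Definition string_eigenvalue (R : realType) (p : R -> R) (alpha beta : R)
    (lambda : R[i]) : Prop :=
  exists u : R -> R[i],
    (exists2 x, x \in `[0, 1] & u x != 0) /\
    string_operator p alpha beta u (fun x => lambda * u x).

(* lambda0 is the lowest eigenvalue; all the eigenvalues are real, because the
   operator is self-adjoint. *)
Definition lowest_eigenvalue (R : realType) (p : R -> R) (alpha beta : R)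
    (lambda0 : R) : Prop :=
  string_eigenvalue p alpha beta lambda0%:C%C /\
  forall mu : R, string_eigenvalue p alpha beta mu%:C%C -> lambda0 <= mu.

(* Main.v *)
Require Import Defs.
From HB Require Import structures.
From mathcomp Require Import all_boot all_order all_algebra.
From mathcomp Require Import complex.
From mathcomp Require Import all_classical all_reals all_analysis.
From mathcomp Require Import measurable_realfun ring lra.

(** Write a real eigenfunction for the eigenvalue [- m] as a pair [(u, v)] with
    [u' = v] and [v' = m p u].

    Lower bounds.  Put [d = u 1 - u 0].  The derivative of
    [u v - 2 d u + d ^ 2 x] is [(v - d) ^ 2 + m p u ^ 2], so for [m >= 0] one
    gets [u 1 v 1 - u 0 v 0 >= d ^ 2], strictly if [m > 0] and [u] is nonzero
    ([energy_ge], in its strict form [energy_gt]).  The boundary conditions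
    force [(u 0, v 0) = r (sin alpha, - cos alpha)] and
    [(u 1, v 1) = t (sin beta, - cos beta)], so the difference
    [d ^ 2 - (u 1 v 1 - u 0 v 0)] is a quadratic form in [(t, r)] with diagonal
    coefficients [sin beta (sin beta + cos beta)] and
    [sin alpha (sin alpha - cos alpha)] and with determinant
    [- sin alpha sin beta Delta].  In the regions of cases (i) and (ii) it is
    positive semidefinite ([boundary_form_le]), which excludes [m > 0].  For
    [m = 0] the solutions are affine and the boundary conditions reduce to
    [r Delta = 0], so [0] is no eigenvalue when [Delta] is nonzero
    ([string_eigenvalue_neq0]).

    Existence.  Let [(u, v)] be the solution with initial value
    [(sin alpha, - cos alpha)] and [D m = u 1 cos beta + v 1 sin beta]; a zero
    [m >= 0] of [D] gives the eigenvalue [- m].  The solution is a power series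
    in [m] whose coefficients are dominated by those of an exponential, hence
    [D] is continuous.  One has [D 0 = - Delta], which settles the upper bound
    in case (i), and [D m > 0] for large [m] because the solution then grows
    fast ([string_solution_growth]).  So a negative eigenvalue exists as soon as
    [D] is nonpositive at some positive [m], or negative at [0].  If
    [Delta > 0] the latter holds.  If [alpha < pi / 4] then [u 1] is negative at
    [m = 0] and positive for large [m]; where it vanishes, [v 1 <= 0] since [u]
    comes down from [u 0 > 0], and therefore [D <= 0].  Outside cases (i) and
    (ii) one of these two situations always occurs. *)

Set Implicit Arguments.
Unset Strict Implicit.
Unset Printing Implicit Defensive.

Import Order.TTheory GRing.Theory Num.Theory.
Import numFieldNormedType.Exports.

Local Open Scope classical_set_scope.
Local Open Scope ring_scope.

(** * Monotonicity in the presence of finitely many exceptional points *)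

(** The derivative is prescribed only off the list [s], so that the discontinuities
    of a density can be ignored; continuity of [F] on the closed interval makes
    up for them. *)
Definition antiderivative_off (R : realType) (s : seq R) (a b : R) (F f : R -> R) : Prop :=
  {within `[a, b], continuous F} /\
  forall x, x \in `]a, b[ -> x \notin s -> is_derive x 1 F (f x).

Lemma antiderivative_offS (R : realType) (s : seq R) (a b c d : R) (F f : R -> R) :
  a <= c -> d <= b -> antiderivative_off s a b F f -> antiderivative_off s c d F f.
Proof.
move=> ac db [cF dF]; split.
  by apply: continuous_subspaceW cF; apply: subset_itv; rewrite bnd_simp.
move=> x; rewrite in_itv/= => /andP[cx xd]; apply: dF; rewrite in_itv/=.
by rewrite (le_lt_trans ac cx) (lt_le_trans xd db).
Qed.

(** Cutting the interval at an exceptional point leaves two intervals with one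
    exceptional point fewer; without any, this is the mean value theorem. *)
Lemma antiderivative_off_le (R : realType) (s : seq R) (a b : R) (F f : R -> R) :
  a <= b -> antiderivative_off s a b F f ->
  (forall x, x \in `]a, b[ -> x \notin s -> 0 <= f x) ->
  F a <= F b.
Proof.
elim: s a b => [|c s IHs] a b ab dF f0.
  move: ab; rewrite le_eqVlt => /predU1P[-> //|ab].
  have [z zab zE] : exists2 c, c \in `]a, b[%R & F b - F a = f c * (b - a).
    by case: dF => cF dF; apply: MVT => // x xab; exact: dF.
  by rewrite -subr_ge0 zE mulr_ge0 ?f0// subr_ge0 ltW.
(* [c] no longer matters on a subinterval that does not contain it *)
have peel a' b' : a <= a' -> b' <= b -> c \notin `]a', b'[ -> a' <= b' -> F a' <= F b'.
  move=> aa' b'b cab ab'.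
  have [cF' dF'] := antiderivative_offS aa' b'b dF.
  have off x : x \in `]a', b'[ -> x \notin s -> x \notin c :: s.
    by move=> xab xs; rewrite inE negb_or xs andbT; apply: contraNneq cab => <-.
  apply: IHs => //; first by split=> // x xab xs; apply: dF' => //; exact: off.
  move=> x xab xs; apply: f0; last exact: off.
  move: xab; rewrite !in_itv/= => /andP[ax xb].
  by rewrite (le_lt_trans aa' ax) (lt_le_trans xb b'b).
have [cab|cab] := boolP (c \in `]a, b[); last exact: peel.
move: cab; rewrite in_itv/= => /andP[ac cb].
have Fac : F a <= F c by apply: peel; rewrite ?in_itv/= ?ltxx ?andbF// ltW.
have Fcb : F c <= F b by apply: peel; rewrite ?in_itv/= ?ltxx// ltW.
exact: le_trans Fac Fcb.
Qed.

Lemma continuous_within_ball (R : realType) (a b x e : R) (w : R -> R) :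
  {within `[a, b], continuous w} -> x \in `[a, b] -> 0 < e ->
  exists2 d, 0 < d &
    forall y, y \in `[a, b] -> `|x - y| < d -> `|w x - w y| <= e.
Proof.
move=> /subspace_continuousP/(_ x) cw xab e0.
have /cvgrPdist_le/(_ _ e0) := cw xab.
rewrite /within/= => /nbhs_ballP[d /= d0 wd]; exists d => // y yab xy.
exact: wd.
Qed.

Lemma continuous_withinD (R : realType) (a b : R) (f g : R -> R) :
  {within `[a, b], continuous f} -> {within `[a, b], continuous g} ->
  {within `[a, b], continuous (fun x => f x + g x)}.
Proof. by move=> cf cg x; apply: cvgD; [exact: cf|exact: cg]. Qed.

Lemma continuous_withinM (R : realType) (a b : R) (f g : R -> R) :
  {within `[a, b], continuous f} -> {within `[a, b], continuous g} ->
  {within `[a, b], continuous (fun x => f x * g x)}.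
Proof. by move=> cf cg x; apply: cvgM; [exact: cf|exact: cg]. Qed.

Lemma antiderivative_off_cst (R : realType) (s : seq R) (a b k : R) :
  antiderivative_off s a b (fun=> k) (fun=> 0).
Proof.
split; last by move=> x _ _; exact: is_derive_cst.
by apply: continuous_subspaceT => x; exact: cvg_cst.
Qed.

Lemma antiderivative_off_id (R : realType) (s : seq R) (a b : R) :
  antiderivative_off s a b id (fun=> 1).
Proof.
split; last by move=> x _ _; exact: is_derive_id.
by apply: continuous_subspaceT => x; exact: cvg_id.
Qed.

Lemma antiderivative_offD (R : realType) (s : seq R) (a b : R) (F f G g : R -> R) :
  antiderivative_off s a b F f -> antiderivative_off s a b G g ->
  antiderivative_off s a b (fun x => F x + G x) (fun x => f x + g x).
Proof.
move=> [cF dF] [cG dG]; split; first exact: continuous_withinD.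
by move=> x xab xs; apply: is_deriveD; [exact: dF|exact: dG].
Qed.

Lemma antiderivative_offM (R : realType) (s : seq R) (a b : R) (F f G g : R -> R) :
  antiderivative_off s a b F f -> antiderivative_off s a b G g ->
  antiderivative_off s a b (fun x => F x * G x) (fun x => F x * g x + f x * G x).
Proof.
move=> [cF dF] [cG dG]; split; first exact: continuous_withinM.
move=> x xab xs; have dFx := dF x xab xs; have dGx := dG x xab xs.
by apply: is_derive_eq; rewrite /GRing.scale/= [G x * _]mulrC.
Qed.

Lemma antiderivative_offN (R : realType) (s : seq R) (a b : R) (F f : R -> R) :
  antiderivative_off s a b F f -> antiderivative_off s a b (fun x => - F x) (fun x => - f x).
Proof.
move=> [cF dF]; split; first by move=> x; apply: cvgN; exact: cF.
by move=> x xab xs; apply: is_deriveN; exact: dF.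
Qed.

Lemma antiderivative_off_ext (R : realType) (s : seq R) (a b : R) (F f g : R -> R) :
  antiderivative_off s a b F f -> (forall x, f x = g x) -> antiderivative_off s a b F g.
Proof. by move=> dF /funext <-. Qed.

(** If [w] were nonzero at a point, [w ^ 2] would stay above a positive constant on
    a whole subinterval, where [F] would grow by a definite amount. *)
Lemma antiderivative_off_eq0 (R : realType) (F f w : R -> R) (s : seq R) (q a b : R) :
  a < b -> 0 < q -> antiderivative_off s a b F f ->
  {within `[a, b], continuous w} ->
  (forall x, x \in `]a, b[ -> x \notin s -> q * w x ^+ 2 <= f x) ->
  F b <= F a -> forall x, x \in `[a, b] -> w x = 0.
Proof.
move=> ab q0 dF cw fw Fba x xab; apply/eqP/negPn/negP => wx0.
have f0 y : y \in `]a, b[ -> y \notin s -> 0 <= f y.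
  by move=> yab ys; apply: le_trans (fw y yab ys); rewrite mulr_ge0 ?sqr_ge0 ?ltW.
have subo c d y : a <= c -> d <= b -> y \in `]c, d[ -> y \in `]a, b[.
  move=> ac db; rewrite !in_itv/= => /andP[cy yd].
  by rewrite (le_lt_trans ac cy) (lt_le_trans yd db).
have Fle c d : a <= c -> c <= d -> d <= b -> F c <= F d.
  move=> ac cd db; apply: (antiderivative_off_le cd (antiderivative_offS ac db dF)).
  by move=> y ycd; apply: f0; exact: subo ycd.
(* an interval around [x] on which [w] stays away from [0] *)
have [c [d [ac cd db wcd]]] : exists c d, [/\ a <= c, c < d, d <= b &
    forall y, y \in `]c, d[ -> `|w x| / 2 <= `|w y| ].
  have wx2 : 0 < `|w x| / 2 by rewrite divr_gt0// normr_gt0.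
  have [e e0 we] := continuous_within_ball cw xab wx2.
  exists (Num.max a (x - e)), (Num.min b (x + e)); split.
  - by rewrite le_max lexx.
  - move: xab; rewrite in_itv/= => /andP[ax xb].
    rewrite lt_min !gt_max ab/=; apply/and3P; split => //; lra.
  - by rewrite ge_min lexx.
  - move=> y; rewrite in_itv/= gt_max lt_min => /andP[/andP[ay xy] /andP[yb yx]].
    have : `|w x - w y| <= `|w x| / 2.
      by apply: we; rewrite ?in_itv/= ?(ltW ay) ?(ltW yb)// ltr_distlC xy yx.
    have := ler_normB (w x - w y) (- w y).
    rewrite opprK subrK normrN; lra.
(* [F' >= k] on [`]c, d[], so [F] minus the line of slope [k] is nondecreasing *)
pose k := q * (`|w x| / 2) ^+ 2.
have k0 : 0 < k by rewrite mulr_gt0// exprn_gt0// divr_gt0// normr_gt0.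
have : F c + - k * c <= F d + - k * d.
  have dk := antiderivative_offM (antiderivative_off_cst s c d (- k)) (antiderivative_off_id s c d).
  have dFk := antiderivative_offD (antiderivative_offS ac db dF) dk.
  apply: (antiderivative_off_le (ltW cd) dFk) => y ycd ys.
  rewrite mul0r addr0 mulr1 subr_ge0; apply: le_trans (fw y (subo c d y ac db ycd) ys).
  rewrite /k ler_pM2l// -[leRHS]real_normK ?num_real//.
  by rewrite lerXn2r ?nnegrE ?divr_ge0// wcd.
have := Fle a c (lexx _) ac (le_trans (ltW cd) db).
have := Fle d b (le_trans ac (ltW cd)) db (lexx _).
have : 0 < k * (d - c) by rewrite mulr_gt0// subr_gt0.
rewrite mulrBr; lra.
Qed.

(** * Energy estimates for the string equation *)

(** The equation [u'' = m p u], that is [- u'' = lambda p u] with [m = - lambda],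
    as a first-order system. *)
Definition string_solution (R : realType) (p : R -> R) (m : R) (u v : R -> R) : Prop :=
  exists s : seq R, antiderivative_off s 0 1 u v /\
    antiderivative_off s 0 1 v (fun x => m * p x * u x).

Lemma string_solution_uv (R : realType) (p u v : R -> R) (m : R) :
  string_solution p m u v -> exists s, antiderivative_off s 0 1 (fun x => u x * v x)
    (fun x => v x ^+ 2 + m * p x * u x ^+ 2).
Proof.
move=> [s [du dv]]; exists s.
apply: antiderivative_off_ext (antiderivative_offM du dv) _ => x; ring.
Qed.

Lemma in_itv01 (R : realType) (c d x : R) :
  0 <= c -> d <= 1 -> x \in `]c, d[ -> x \in `[0, 1].
Proof.
move=> c0 d1; rewrite !in_itv/= => /andP[cx xd].
by rewrite (le_trans c0 (ltW cx)) (le_trans (ltW xd) d1).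
Qed.

Lemma string_solution_uv_le (R : realType) (p u v : R -> R) (m c d : R) :
  density p -> 0 <= m -> string_solution p m u v ->
  0 <= c -> c <= d -> d <= 1 -> u c * v c <= u d * v d.
Proof.
move=> [_ p0 _] m0 /string_solution_uv[s duv] c0 cd d1.
apply: (antiderivative_off_le cd (antiderivative_offS c0 d1 duv)) => x xcd _.
by rewrite addr_ge0 ?sqr_ge0// mulr_ge0 ?sqr_ge0// mulr_ge0// ltW// p0// (in_itv01 c0 d1 xcd).
Qed.

(** Since [(u v)' >= v ^ 2], the product [u v] can only be constant where [v]
    vanishes. *)
Lemma string_solution_uv_stationary (R : realType) (p u v : R -> R) (m c d : R) :
  density p -> 0 <= m -> string_solution p m u v ->
  0 <= c -> c < d -> d <= 1 -> u d * v d <= u c * v c ->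
  forall x, x \in `[c, d] -> v x = 0.
Proof.
move=> [_ p0 _] m0 sol c0 cd d1.
have [s duv] := string_solution_uv sol.
have [s' [_ /(antiderivative_offS c0 d1) [cv _]]] := sol.
apply: (antiderivative_off_eq0 cd ltr01 (antiderivative_offS c0 d1 duv)) => //.
move=> x xcd _; rewrite mul1r lerDl.
by rewrite mulr_ge0 ?sqr_ge0// mulr_ge0// ltW// p0// (in_itv01 c0 d1 xcd).
Qed.

Lemma string_solution_v_eq0 (R : realType) (p u v : R -> R) (m c d : R) :
  density p -> 0 <= m -> string_solution p m u v ->
  0 <= c -> c < d -> d <= 1 -> (forall x, x \in `[c, d] -> u x = 0) ->
  forall x, x \in `[c, d] -> v x = 0.
Proof.
move=> dp m0 sol c0 cd d1 u0; apply: (string_solution_uv_stationary dp m0 sol) => //.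
by rewrite !u0 ?mul0r// in_itv/= lexx ltW.
Qed.

(** The function whose monotonicity compares [u v] at the two ends with the energy
    [d ^ 2] of the chord of [u], without integrating [v ^ 2]. *)
Lemma antiderivative_off_chord (R : realType) (s : seq R) (p u v : R -> R) (m : R) :
  antiderivative_off s 0 1 u v ->
  antiderivative_off s 0 1 v (fun x => m * p x * u x) ->
  let d := u 1 - u 0 in
  antiderivative_off s 0 1 (fun x => u x * v x + (- (2 * d) * u x + d ^+ 2 * x))
    (fun x => (v x - d) ^+ 2 + m * p x * u x ^+ 2).
Proof.
move=> du dv d.
have dcst k := antiderivative_off_cst s (0 : R) 1 k.
have := antiderivative_offD (antiderivative_offM du dv) (antiderivative_offD
  (antiderivative_offM (dcst (- (2 * d))) du)
  (antiderivative_offM (dcst (d ^+ 2)) (antiderivative_off_id s 0 1))).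
move/antiderivative_off_ext; apply => x; ring.
Qed.

Lemma energy_ge (R : realType) (p u v : R -> R) (m : R) :
  density p -> 0 <= m -> string_solution p m u v ->
  (u 1 - u 0) ^+ 2 <= u 1 * v 1 - u 0 * v 0.
Proof.
move=> [_ p0 _] m0 [s [du dv]].
have := antiderivative_off_le ler01 (antiderivative_off_chord du dv).
suff /[swap]/[apply]/= : forall x, x \in `]0, 1[ -> x \notin s ->
    0 <= (v x - (u 1 - u 0)) ^+ 2 + m * p x * u x ^+ 2 by nra.
move=> x x01 _; rewrite addr_ge0 ?sqr_ge0// mulr_ge0 ?sqr_ge0// mulr_ge0// ltW//.
by apply: p0; exact: subset_itv_oo_cc x01.
Qed.

Lemma energy_gt (R : realType) (p u v : R -> R) (m : R) :
  density p -> 0 < m -> string_solution p m u v ->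
  (exists2 x, x \in `[0, 1] & u x != 0) ->
  (u 1 - u 0) ^+ 2 < u 1 * v 1 - u 0 * v 0.
Proof.
move=> [_ p0 [c c0 cp]] m0 [s [du dv]] [y y01 uy0].
rewrite ltNge; apply/negP => uvle.
suff u0 : u y = 0 by rewrite u0 eqxx in uy0.
apply: (antiderivative_off_eq0 ltr01 (mulr_gt0 m0 c0) (antiderivative_off_chord du dv)) y01.
- exact: du.1.
- move=> x /subset_itv_oo_cc x01 _; rewrite -[leLHS]add0r lerD ?sqr_ge0//.
  by rewrite ler_wpM2r ?sqr_ge0// ler_pM2l// cp.
- nra.
Qed.

(** The slope [theta] goes linearly from [k] to [- l]. Completing the square leaves
    a multiple of [u ^ 2] that is positive once [m p] exceeds
    [theta ^ 2 - theta']; then a bound [- k] from below on [v / u] at [0] is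
    turned into the bound [l] at [1]. *)
Lemma antiderivative_off_riccati (R : realType) (s : seq R) (p u v : R -> R) (m k l : R) :
  antiderivative_off s 0 1 u v ->
  antiderivative_off s 0 1 v (fun x => m * p x * u x) ->
  let theta x := k - (k + l) * x in
  antiderivative_off s 0 1 (fun x => u x * v x + theta x * u x ^+ 2)
    (fun x => (v x + theta x * u x) ^+ 2 + (m * p x - (k + l) - theta x ^+ 2) * u x ^+ 2).
Proof.
move=> du dv theta.
have dcst k := antiderivative_off_cst s (0 : R) 1 k.
have dtheta := antiderivative_offD (dcst k) (antiderivative_offN
  (antiderivative_offM (dcst (k + l)) (antiderivative_off_id s 0 1))).
have := antiderivative_offD (antiderivative_offM du dv)
   (antiderivative_offM dtheta (antiderivative_offM du du)).
move/antiderivative_off_ext; apply => x; rewrite /theta; ring.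
Qed.

Lemma continuous_within_zero (R : realType) (a b : R) (f : R -> R) :
  a <= b -> {within `[a, b], continuous f} -> f a * f b <= 0 ->
  exists2 c, c \in `[a, b] & f c = 0.
Proof.
move=> ab cf fab; apply: IVT => //.
rewrite ge_min le_max.
have [fa|fa] := lerP (f a) 0; have [fb|fb] := lerP (f b) 0 => //=; nra.
Qed.

(** By monotonicity of [F = u v + theta u ^ 2], starting from [F 0 >= 0], a zero of
    [u] after [0] would make [F], hence [u], vanish on an initial interval. So
    [u] keeps its initial sign, and [F 1 >= 0] compares [v 1] with [l u 1]. *)
Lemma string_solution_growth (R : realType) (p u v : R -> R) (m k l c : R) :
  density p -> 0 < c -> (forall x, x \in `[0, 1] -> c <= p x) ->
  0 <= k -> 0 <= l -> (k + l) ^+ 2 + (k + l) + 1 <= m * c ->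
  string_solution p m u v ->
  0 < u 0 \/ [/\ u 0 = 0, k = 0 & 0 < v 0] ->
  0 <= u 0 * v 0 + k * u 0 ^+ 2 ->
  0 < u 1 /\ l * u 1 <= v 1.
Proof.
move=> dp c0 cp k0 l0 mc sol init F0.
have m0 : 0 <= m.
  rewrite -(pmulr_lge0 m c0); apply: le_trans mc.
  by rewrite !addr_ge0// exprn_ge0// addr_ge0.
have [s [du dv]] := sol.
pose theta x := k - (k + l) * x.
pose F x := u x * v x + theta x * u x ^+ 2.
have dF := antiderivative_off_riccati k l du dv.
have F'ge x : x \in `]0, 1[ -> 1 * u x ^+ 2 <=
    (v x + theta x * u x) ^+ 2 + (m * p x - (k + l) - theta x ^+ 2) * u x ^+ 2.
  move=> x01; rewrite -[leLHS]add0r lerD ?sqr_ge0// ler_wpM2r ?sqr_ge0//.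
  have := cp x (subset_itv_oo_cc x01).
  move: x01; rewrite in_itv/= => /andP[x0 x1] /(ler_wpM2l m0).
  have : theta x ^+ 2 <= (k + l) ^+ 2.
    have -> : theta x ^+ 2 = (k + l) ^+ 2 -
        (l + (k + l) * x) * (k + (k + l) * (1 - x)) by rewrite /theta; ring.
    have x1' := ltW x1; have x0' := ltW x0.
    rewrite gerBl mulr_ge0//; apply: addr_ge0 => //; apply: mulr_ge0; rewrite ?subr_ge0 ?addr_ge0//.
  lra.
have Fge0 x : x \in `[0, 1] -> 0 <= F x.
  rewrite in_itv/= => /andP[x0 x1].
  apply: (@le_trans _ _ (F 0)); first by rewrite /F/theta mulr0 subr0.
  apply: (antiderivative_off_le x0 (antiderivative_offS (lexx 0) x1 dF)) => y y0x _.
  have /F'ge : y \in `]0, 1[.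
    by move: y0x; rewrite !in_itv/= => /andP[-> /lt_le_trans ->].
  by apply: le_trans; rewrite mul1r sqr_ge0.
have une0 x : x \in `]0, 1] -> u x != 0.
  rewrite in_itv/= => /andP[x0 x1]; apply/eqP => ux0.
  have u0x : forall y, y \in `[0, x] -> u y = 0.
    apply: (antiderivative_off_eq0 x0 ltr01 (antiderivative_offS (lexx 0) x1 dF)).
    - exact: (antiderivative_offS (lexx 0) x1 du).1.
    - move=> y y0x _; apply: F'ge.
      by move: y0x; rewrite !in_itv/= => /andP[-> /lt_le_trans ->].
    - rewrite ux0 expr0n/= !mul0r mulr0 addr0.
      by have := Fge0 0; rewrite in_itv/= lexx ler01 /F/theta; exact.
  have v0x := string_solution_v_eq0 dp m0 sol (lexx 0) x0 x1 u0x.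
  have zero0 : 0 \in `[0, x] by rewrite in_itv/= lexx ltW.
  by case: init => [|[_ _]]; rewrite ?u0x ?v0x ?ltxx.
have cu := du.1.
have no_zero x : x \in `]0, 1] -> 0 < u x * u 1.
  move=> /[dup] x01; rewrite in_itv/= => /andP[x0 x1].
  rewrite ltNge; apply/negP => xu1.
  have [y] := continuous_within_zero x1 (antiderivative_offS (ltW x0) (lexx 1) du).1 xu1.
  rewrite in_itv/= => /andP[xy y1]; apply/eqP/une0.
  by rewrite in_itv/= y1 (lt_le_trans x0).
have u1 : 0 < u 1.
  rewrite ltNge; apply/negP => u1.
  case: init => [u0|[u0 k00 v0]].
    have u01 : u 0 * u 1 <= 0 by rewrite mulr_ge0_le0// ltW.
    have [y] := continuous_within_zero ler01 cu u01.
    rewrite in_itv/= le_eqVlt => /andP[/predU1P[<-|y0] y1].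
      by move/eqP; rewrite gt_eqF.
    by apply/eqP/une0; rewrite in_itv/= y0.
  have zero01 : (0 : R) \in `[0, 1] by rewrite in_itv/= lexx ler01.
  have [e e0 ev] := continuous_within_ball dv.1 zero01 (divr_gt0 v0 (ltr0Sn _ 1)).
  pose x := Num.min 1 (e / 2).
  have x0 : 0 < x by rewrite lt_min ltr01 divr_gt0.
  have x1 : x <= 1 by rewrite ge_min lexx.
  have vx : 0 < v x.
    have : `|v 0 - v x| <= v 0 / 2.
      apply: ev; first by rewrite in_itv/= x1 ltW.
      rewrite sub0r normrN gtr0_norm//.
      have : x <= e / 2 by rewrite ge_min lexx orbT.
      lra.
    by rewrite ler_norml => /andP[_]; lra.
  have ux : u x < 0.
    have := no_zero x; rewrite in_itv/= x0 x1 => /(_ isT); nra.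
  have := Fge0 x; rewrite in_itv/= x1 (ltW x0) => /(_ isT).
  rewrite /F /theta k00 sub0r add0r leNgt mulNr => /negP; apply.
  have : u x * v x < 0 by rewrite pmulr_llt0.
  have : 0 <= l * x * u x ^+ 2 by rewrite mulr_ge0 ?sqr_ge0 ?mulr_ge0 ?(ltW x0)//.
  lra.
split => //.
have := Fge0 1; rewrite in_itv/= lexx ler01 /F/theta mulr1 => /(_ isT).
by rewrite opprD addNKr mulNr subr_ge0 expr2 mulrA [_ * v 1]mulrC ler_pM2r.
Qed.

(** If [v 1] were positive, [u] would be nonpositive shortly before [1], as [u v]
    increases to [0]; it would then vanish at an earlier point, and [u v] would
    be constant, with [v = 0], from there to [1]. *)
Lemma string_solution_first_zero (R : realType) (p u v : R -> R) (m : R) :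
  density p -> 0 <= m -> string_solution p m u v ->
  0 < u 0 -> u 1 = 0 -> v 1 <= 0.
Proof.
move=> dp m0 sol u0 u1; rewrite leNgt; apply/negP => v1.
have [s [du dv]] := sol.
have one01 : (1 : R) \in `[0, 1] by rewrite in_itv/= lexx ler01.
have [e e0 ev] := continuous_within_ball dv.1 one01 (divr_gt0 v1 (ltr0Sn _ 1)).
pose y := Num.max 0 (1 - e / 2).
have y0 : 0 <= y by rewrite le_max lexx.
have y1 : y < 1 by rewrite gt_max ltr01/=; lra.
have vy : 0 < v y.
  have : `|v 1 - v y| <= v 1 / 2.
    apply: ev; first by rewrite in_itv/= y0 ltW.
    rewrite gtr0_norm ?subr_gt0//.
    have : 1 - e / 2 <= y by rewrite le_max lexx orbT.
    lra.
  by rewrite ler_norml => /andP[_]; lra.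
have uy : u y <= 0.
  have := string_solution_uv_le dp m0 sol y0 (ltW y1) (lexx 1).
  by rewrite u1 mul0r pmulr_lle0.
have uy0 : u 0 * u y <= 0 by rewrite mulr_ge0_le0// ltW.
have [x] := continuous_within_zero y0 (antiderivative_offS (lexx 0) (ltW y1) du).1 uy0.
rewrite in_itv/= => /andP[x0 xy] ux.
have := string_solution_uv_stationary dp m0 sol x0 (le_lt_trans xy y1) (lexx 1).
rewrite ux u1 !mul0r lexx => /(_ isT 1); rewrite in_itv/= lexx (ltW (le_lt_trans xy y1)).
by move=> /(_ isT) v10; rewrite v10 ltxx in v1.
Qed.

(** With [(u0, v0) = r (sa, - ca)] and [(u1, v1) = t (sb, - cb)], the difference of
    the two sides is a quadratic form in [(t, r)] with nonnegative diagonal and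
    nonnegative determinant. *)
Lemma boundary_form_le (R : realType) (sa ca sb cb u0 v0 u1 v1 : R) :
  sa ^+ 2 + ca ^+ 2 = 1 -> sb ^+ 2 + cb ^+ 2 = 1 ->
  0 <= sa -> 0 <= sb -> 0 <= sa - ca -> 0 <= sb + cb ->
  ca * cb - (sa * cb - ca * sb) <= 0 ->
  u0 * ca + v0 * sa = 0 -> u1 * cb + v1 * sb = 0 ->
  u1 * v1 - u0 * v0 <= (u1 - u0) ^+ 2.
Proof.
move=> sca scb sa0 sb0 sca0 scb0 D0 bc0 bc1.
(* coordinates along the unit vectors orthogonal to [(ca, sa)] and [(cb, sb)] *)
pose r := u0 * sa - v0 * ca; pose t := u1 * sb - v1 * cb.
have u0E : u0 = r * sa.
  rewrite -[LHS]mulr1 -sca /r -[LHS]subr0 -[X in _ - X](mulr0 ca) -bc0; ring.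
have v0E : v0 = - r * ca.
  rewrite -[LHS]mulr1 -sca /r -[LHS]subr0 -[X in _ - X](mulr0 sa) -bc0; ring.
have u1E : u1 = t * sb.
  rewrite -[LHS]mulr1 -scb /t -[LHS]subr0 -[X in _ - X](mulr0 cb) -bc1; ring.
have v1E : v1 = - t * cb.
  rewrite -[LHS]mulr1 -scb /t -[LHS]subr0 -[X in _ - X](mulr0 sb) -bc1; ring.
rewrite u0E v0E u1E v1E -subr_ge0.
have -> : (t * sb - r * sa) ^+ 2 - (t * sb * (- t * cb) - r * sa * (- r * ca)) =
  sb * (sb + cb) * t ^+ 2 - 2 * (sa * sb) * (t * r) + sa * (sa - ca) * r ^+ 2 by ring.
have A0 : 0 <= sb * (sb + cb) by rewrite mulr_ge0.
have C0 : 0 <= sa * (sa - ca) by rewrite mulr_ge0.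
have AC : (sa * sb) ^+ 2 <= (sb * (sb + cb)) * (sa * (sa - ca)).
  have : 0 <= (sa * sb) * - (ca * cb - (sa * cb - ca * sb)).
    by rewrite mulr_ge0 ?oppr_ge0 ?mulr_ge0.
  lra.
set A := sb * (sb + cb) in A0 AC *; set C := sa * (sa - ca) in C0 AC *.
set B := sa * sb in AC *.
(* a semidefinite form with [A = 0] has no mixed term; otherwise complete the square *)
have [A00|A00] := eqVneq A 0.
  have B0 : B = 0 by apply/eqP; rewrite -sqrf_eq0 eq_le sqr_ge0 andbT (le_trans AC)// A00 mul0r.
  by rewrite A00 B0 mulr0 !mul0r subrr add0r mulr_ge0 ?sqr_ge0.
have Ap : 0 < A by rewrite lt_neqAle eq_sym A00.
rewrite -(pmulr_rge0 _ Ap).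
have -> : A * (A * t ^+ 2 - 2 * B * (t * r) + C * r ^+ 2) =
  (A * t - B * r) ^+ 2 + (A * C - B ^+ 2) * r ^+ 2 by ring.
by rewrite addr_ge0 ?sqr_ge0// mulr_ge0 ?sqr_ge0// subr_ge0.
Qed.

(** * Regularity of densities and of indefinite integrals *)

Local Notation mu := lebesgue_measure.

(** A class of integrands that contains the densities and the continuous functions,
    is closed under products and is integrable on every [`[0, x]]. *)
Definition bounded_measurable (R : realType) (f : R -> R) : Prop :=
  measurable_fun (`[0, 1] : set R) f /\
  exists2 M : R, 0 <= M & forall x : R, x \in `[0, 1] -> `|f x| <= M.

Lemma measurable_seq (R : realType) (s : seq R) : measurable [set` s].
Proof.
by apply: countable_measurable => //; apply: finite_set_countable; exact: finite_seq.
Qed.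

Lemma measurable_fun_finite (R : realType) (s : seq R) (f : R -> R) :
  measurable_fun [set` s] f.
Proof.
elim: s => [|a s IHs]; first by rewrite set_nil; exact: measurable_fun_set0.
have -> : [set` a :: s] = [set a] `|` [set` s].
  apply/seteqP; split => x /=; first by rewrite inE => /orP[/eqP|]; [left|right].
  by move=> [->|]; rewrite inE ?eqxx// => ->; rewrite orbT.
apply/measurable_funU => //; last by split => //; exact: measurable_fun_set1.
exact: measurable_seq.
Qed.

Lemma density_measurable (R : realType) (p : R -> R) :
  density p -> measurable_fun (`[0, 1] : set R) p.
Proof.
move=> [[[s cp] _ _] _ _].
(* the continuity set of [p] is open, and what remains of [`[0, 1]] is finite *)
pose O := (`]0, 1[ : set R) `&` ~` [set` s].
have oO : open O.
  apply: openI; first exact: interval_open.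
  apply: closed_openC; apply: (iffLR accessible_finite_set_closed); last exact: finite_seq.
  exact: hausdorff_accessible (@Rhausdorff R).
apply: (@measurable_funS _ _ _ _ (O `|` [set` 0 :: 1 :: s])).
- by apply: measurableU; [exact: open_measurable|exact: measurable_seq].
- move=> x /=; rewrite in_itv/= => /andP[x0 x1].
  have [xs|xs] := boolP (x \in 0 :: 1 :: s); [by right|left].
  move: xs; rewrite !inE !negb_or => /and3P[xn0 xn1 /negP xs].
  by split => //=; rewrite in_itv/= !lt_neqAle eq_sym xn0 x0 xn1.
- apply/measurable_funU; [exact: open_measurable|exact: measurable_seq|].
  split; last exact: measurable_fun_finite.
  apply: open_continuous_measurable_fun => // x.
  by rewrite inE/= => -[x01 /negP xs]; exact: cp.
Qed.

(** The one-sided limits bound [p] on both sides of each point, and compactness of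
    [`[0, 1]] makes the bound uniform. *)
Lemma density_bounded (R : realType) (p : R -> R) :
  density p -> exists2 M : R, 0 <= M & forall x : R, x \in `[0, 1] -> `|p x| <= M.
Proof.
move=> [[_ cpr cpl] _ _].
have /compact_near_coveringP := @segment_compact R 0 1.
move=> /(_ R (pinfty_nbhs R) (fun M x => x \in `[0, 1] -> `|p x| <= M) _).
case.
- move=> x /= x01.
  have right_bound : exists2 M, 0 <= M & \forall y \near x, x < y -> y \in `[0, 1] -> `|p y| <= M.
    have [x1|x1] := ltP x 1.
      have : cvg (p y @[y --> x^'+]).
        by apply: cpr; rewrite in_itv/= x1 andbT; move: x01; rewrite in_itv/= => /andP[].
      move/cvg_bounded => [M [_ /(_ (Num.max M 0 + 1)) b]]; exists (Num.max M 0 + 1).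
        by rewrite addr_ge0// le_max lexx orbT.
      have ltM : M < Num.max M 0 + 1 by rewrite ltr_pwDr// le_max lexx.
      have H : \forall y \near x, x < y -> `|p y| <= Num.max M 0 + 1 := b ltM.
      by apply: filterS H => y pb xy _; exact: pb.
    exists 0 => //; apply: (@filterE _ (nbhs x)) => y xy; rewrite in_itv/= => /andP[_ y1].
    by move: (le_lt_trans x1 xy); rewrite ltNge y1.
  have left_bound : exists2 M, 0 <= M & \forall y \near x, y < x -> y \in `[0, 1] -> `|p y| <= M.
    have [x1|x1] := ltP 0 x.
      have : cvg (p y @[y --> x^'-]).
        by apply: cpl; rewrite in_itv/= x1; move: x01; rewrite in_itv/= => /andP[].
      move/cvg_bounded => [M [_ /(_ (Num.max M 0 + 1)) b]]; exists (Num.max M 0 + 1).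
        by rewrite addr_ge0// le_max lexx orbT.
      have ltM : M < Num.max M 0 + 1 by rewrite ltr_pwDr// le_max lexx.
      have H : \forall y \near x, y < x -> `|p y| <= Num.max M 0 + 1 := b ltM.
      by apply: filterS H => y pb xy _; exact: pb.
    exists 0 => //; apply: (@filterE _ (nbhs x)) => y xy; rewrite in_itv/= => /andP[y0 _].
    by move: (lt_le_trans xy x1); rewrite ltNge y0.
  case: right_bound => M1 M10 rb; case: left_bound => M2 M20 lb.
  exists ([set y | (x < y -> y \in `[0, 1] -> `|p y| <= M1) /\
                   (y < x -> y \in `[0, 1] -> `|p y| <= M2)],
          [set M | M1 + M2 + `|p x| <= M]).
    split; first exact: filterI.
    exact: nbhs_pinfty_ge (num_real _).
  move=> [y M] /= [[yr yl]] MM y01; apply: le_trans MM.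
  case: (ltgtP x y) => [xy|yx|<-].
  - by apply: le_trans (yr xy y01) _; rewrite -addrA lerDl addr_ge0.
  - by apply: le_trans (yl yx y01) _; rewrite addrAC lerDr addr_ge0.
  - by rewrite lerDr addr_ge0.
- move=> M [_ MP]; exists (`|M| + 1); first by rewrite addr_ge0.
  move=> x x01; apply: (MP (`|M| + 1)) => //.
  by rewrite ltr_pwDr// ler_norm.
Qed.

Lemma subset_itv01 (R : realType) (x : R) : x <= 1 -> `[0, x] `<=` (`[0, 1] : set R).
Proof. by move=> x1; apply: subset_itvl; rewrite bnd_simp. Qed.

Lemma bounded_measurable_integrable (R : realType) (f : R -> R) (x : R) :
  bounded_measurable f -> x <= 1 -> mu.-integrable `[0, x] (EFin \o f).
Proof.
move=> [mf [M M0 fM]] x1; have int01 : mu.-integrable `[0, 1] (EFin \o f).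
  apply: measurable_bounded_integrable => //.
    exact: compact_finite_measure (@segment_compact R 0 1).
  exists M; split; first exact: num_real.
  by move=> N MN t /= t01; apply: le_trans (fM t t01) (ltW MN).
by apply: integrableS int01 => //; exact: subset_itv01.
Qed.

Lemma continuous_bounded_measurable (R : realType) (f : R -> R) :
  {within `[0, 1], continuous f} -> bounded_measurable f.
Proof.
move=> cf; split; first exact: subspace_continuous_measurable_fun.
have /compact_bounded[M [_ fM]] := continuous_compact cf (@segment_compact R 0 1).
exists (`|M| + 1) => [|x x01]; first by rewrite addr_ge0.
by apply: fM; [rewrite ltr_pwDr// ler_norm|exists x].
Qed.

Lemma bounded_measurableM (R : realType) (f g : R -> R) :
  bounded_measurable f -> bounded_measurable g -> bounded_measurable (fun x => f x * g x).
Proof.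
move=> [mf [M M0 fM]] [mg [N N0 gN]]; split; first exact: measurable_funM.
exists (M * N) => [|x x01]; first exact: mulr_ge0.
by rewrite normrM ler_pM ?fM ?gN.
Qed.

Lemma bounded_measurableD (R : realType) (f g : R -> R) :
  bounded_measurable f -> bounded_measurable g -> bounded_measurable (fun x => f x + g x).
Proof.
move=> [mf [M M0 fM]] [mg [N N0 gN]]; split; first exact: measurable_funD.
exists (M + N) => [|x x01]; first exact: addr_ge0.
by rewrite (le_trans (ler_normD _ _))// lerD ?fM ?gN.
Qed.

Lemma bounded_measurable_cst (R : realType) (k : R) : bounded_measurable (fun=> k : R).
Proof. by split => //; exists `|k|. Qed.

Lemma density_bounded_measurable (R : realType) (p : R -> R) :
  density p -> bounded_measurable p.
Proof. by move=> dp; split; [exact: density_measurable|exact: density_bounded]. Qed.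

Lemma primitive_continuous (R : realType) (F f : R -> R) :
  primitive F f -> {within `[0, 1], continuous F}.
Proof.
move=> [intf FE]; have := parameterized_integral_continuous ler01 intf.
move=> cI; apply: (@subspace_eq_continuous _ _ _ (fun x => F 0 + parameterized_integral mu 0 x f)).
  by move=> x; rewrite inE/= => x01; exact: esym (FE x x01).
by move=> x; apply: cvgD; [exact: cvg_cst|exact: cI].
Qed.

Lemma primitive_is_derive (R : realType) (F f : R -> R) (x : R) :
  primitive F f -> x \in `]0, 1[ -> {for x, continuous f} -> is_derive x 1 F (f x).
Proof.
move=> [intf FE]; rewrite in_itv/= => /andP[x0 x1] cf.
have [dI I'] := continuous_FTC1_closed x1 intf x0 cf.
have dG : is_derive x 1 (fun x => F 0 + parameterized_integral mu 0 x f) (f x).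
  rewrite -[f x]add0r; apply: is_deriveD.
  by rewrite -I' derive1E; exact: DeriveDef.
apply: near_eq_is_derive dG.
near=> y; apply/esym/FE/subset_itv_oo_cc; near: y.
by apply: near_in_itvoo; rewrite in_itv/= x0.
Unshelve. all: by end_near. Qed.

Lemma primitive_antiderivative_off (R : realType) (F f : R -> R) (s : seq R) :
  primitive F f -> (forall x, x \in `]0, 1[ -> x \notin s -> {for x, continuous f}) ->
  antiderivative_off s 0 1 F f.
Proof.
move=> Ff cf; split; first exact: primitive_continuous Ff.
by move=> x x01 xs; apply: primitive_is_derive => //; exact: cf.
Qed.

(** The bridge from absolutely continuous solutions to the system: off the
    discontinuities of [p] all the integrands are continuous, so the indefinite
    integrals are differentiable there. *)
Lemma primitive_string_solution (R : realType) (p u v : R -> R) (m : R) :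
  density p -> primitive u v -> primitive v (fun x => m * p x * u x) ->
  string_solution p m u v.
Proof.
move=> [[[s cp] _ _] _ _] uv vw; exists s; split.
  apply: primitive_antiderivative_off => // x x01 _.
  exact: within_continuous_continuous ltr01 (primitive_continuous vw) x01.
apply: primitive_antiderivative_off => // x x01 xs.
have cu := within_continuous_continuous ltr01 (primitive_continuous uv) x01.
apply: continuousM cu; apply: continuousM (cp x x01 xs); exact: cst_continuous.
Qed.

(** Used to replace the second derivative of an eigenfunction, known only almost
    everywhere, by the piecewise continuous function [- lambda p u]. *)
Lemma primitive_ae (R : realType) (F f g : R -> R) :
  primitive F f -> bounded_measurable g ->
  {ae (@lebesgue_measure R), forall x, x \in `[0, 1] -> f x = g x} -> primitive F g.
Proof.
move=> [intf FE] bg fg; split; first exact: bounded_measurable_integrable.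
move=> x x01; rewrite FE//; congr (_ + _); rewrite /Rintegral; congr fine.
move: x01; rewrite in_itv/= => /andP[_ x1].
apply: ae_eq_integral => //.
- have : mu.-integrable `[0, x] (EFin \o f).
    by apply: integrableS intf => //; exact: subset_itv01.
  by move/integrableP => [].
- by have /integrableP[] := bounded_measurable_integrable bg x1.
- move: fg; apply: filterS; first exact: (ae_filter_ringOfSetsType mu).
  by move=> t fgt /(subset_itv01 x1) t01; rewrite /= fgt.
Qed.

(** * Power series dominated by the exponential series *)

(** Power series with such coefficients converge everywhere, and the class is stable
    under termwise differentiation, which is what continuity of the sum needs. *)
Definition factorially_bounded (R : realType) (c : nat -> R) : Prop :=
  exists C M, [/\ 0 <= C, 0 <= M & forall n, `|c n| <= C * M ^+ n / n`!%:R].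

Lemma factorially_bounded_term (R : realType) (c : nat -> R) (C M m : R) (n : nat) :
  `|c n| <= C * M ^+ n / n`!%:R -> `|c n * m ^+ n| <= C * exp_coeff (M * `|m|) n.
Proof.
move=> cn; rewrite normrM normrX /exp_coeff/= exprMn.
have -> : C * (M ^+ n * `|m| ^+ n / n`!%:R) = C * M ^+ n / n`!%:R * `|m| ^+ n.
  by rewrite mulrA [RHS]mulrAC mulrA.
by rewrite ler_wpM2r// exprn_ge0.
Qed.

(** The bound is uniform in the number of terms, as dominated convergence
    requires. *)
Lemma pseries_le (R : realType) (c : nat -> R) (C M m : R) (n : nat) :
  0 <= C -> 0 <= M -> (forall n, `|c n| <= C * M ^+ n / n`!%:R) ->
  `|pseries c m n| <= C * expR (M * `|m|).
Proof.
move=> C0 M0 cC; rewrite /pseries /series/=.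
apply: le_trans (ler_norm_sum _ _ _) _.
apply: (@le_trans _ _ (\sum_(0 <= i < n) C * exp_coeff (M * `|m|) i)).
  by apply: ler_sum => i _; exact: factorially_bounded_term.
rewrite -mulr_sumr ler_wpM2l// /expR.
apply: (@nondecreasing_cvgn_le _ (series (exp_coeff (M * `|m|)))).
  by apply: nondecreasing_series => i _ _; rewrite exp_coeff_ge0// mulr_ge0.
exact: is_cvg_series_exp_coeff.
Qed.

Lemma factorially_bounded_cvg (R : realType) (c : nat -> R) (m : R) :
  factorially_bounded c -> cvgn (pseries c m).
Proof.
move=> [C [M [C0 M0 cC]]]; apply: normed_cvg.
apply: (@series_le_cvg _ _ (fun n => C * exp_coeff (M * `|m|) n)).
- by move=> n; exact: normr_ge0.
- by move=> n; rewrite mulr_ge0// exp_coeff_ge0// mulr_ge0.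
- by move=> n; exact: factorially_bounded_term.
- have : cvgn (C *: series (exp_coeff (M * `|m|))).
    by apply: is_cvgZr; exact: is_cvg_series_exp_coeff.
  suff -> : series (fun n => C * exp_coeff (M * `|m|) n) = C *: series (exp_coeff (M * `|m|)) by [].
  by apply/funext => n; rewrite /series/= -mulr_sumr.
Qed.

Lemma factorially_bounded_diffs (R : realType) (c : nat -> R) :
  factorially_bounded c -> factorially_bounded (pseries_diffs c).
Proof.
move=> [C [M [C0 M0 cC]]]; exists (C * M), M; split=> // [|n]; first exact: mulr_ge0.
rewrite /pseries_diffs normrM normr_nat.
apply: le_trans (ler_wpM2l (ler0n _ _) (cC n.+1)) _.
rewrite factS natrM invfM exprS le_eqVlt; apply/orP; left; apply/eqP.
have n1 : n.+1%:R != 0 :> R by rewrite pnatr_eq0.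
have nf : n`!%:R != 0 :> R by rewrite pnatr_eq0 -lt0n fact_gt0.
by move: (n.+1%:R : R) (n`!%:R : R) n1 nf => a b a0 b0; field; rewrite a0 b0.
Qed.

Lemma pseries_continuous (R : realType) (c : nat -> R) :
  factorially_bounded c -> continuous (fun m => limn (pseries c m)).
Proof.
move=> bc m; have bd := factorially_bounded_diffs bc.
have : is_derive m (1 : R) (fun m => limn (pseries c m)) (limn (pseries (pseries_diffs c) m)).
  apply: (@pseries_snd_diffs _ c (`|m| + 1)); try exact: factorially_bounded_cvg.
    by apply: factorially_bounded_cvg; exact: factorially_bounded_diffs.
  by rewrite [ltRHS]ger0_norm ?addr_ge0// ltrDl.
by move=> [dm _]; apply: differentiable_continuous; exact/derivable1_diffP.
Qed.

(** * Construction of the solution as a power series in the parameter *)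

(** The coefficients of [m ^ n] in the solution [(u, v)] with initial value [(a, b)],
    found by comparing powers of [m] in [u = a + int v] and
    [v = b + m int p u]. *)
Fixpoint string_coeff (R : realType) (p : R -> R) (a b : R) (n : nat) : (R -> R) * (R -> R) :=
  if n is k.+1 then
    let psi x := \int[lebesgue_measure]_(t in `[0, x]) (p t * (string_coeff p a b k).1 t) in
    (fun x => \int[lebesgue_measure]_(t in `[0, x]) psi t, psi)
  else (fun x => a + b * x, fun=> b).

Lemma bounded_measurable_int_continuous (R : realType) (f : R -> R) :
  bounded_measurable f ->
  {within `[0, 1], continuous (fun x => \int[mu]_(t in `[0, x]) f t)}.
Proof.
move=> bf; apply: parameterized_integral_continuous ler01 _.
exact: bounded_measurable_integrable.
Qed.

Lemma string_coeff_continuous (R : realType) (p : R -> R) (a b : R) (n : nat) :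
  bounded_measurable p ->
  {within `[0, 1], continuous (string_coeff p a b n).1} /\
  {within `[0, 1], continuous (string_coeff p a b n).2}.
Proof.
move=> bp; elim: n => [|n [IH1 _]] /=.
  split; apply: continuous_subspaceT => x; last exact: cvg_cst.
  by apply: cvgD; [exact: cvg_cst|apply: cvgM; [exact: cvg_cst|exact: cvg_id]].
have c2 : {within `[0, 1], continuous
    (fun x => \int[mu]_(t in `[0, x]) (p t * (string_coeff p a b n).1 t))}.
  apply: bounded_measurable_int_continuous; apply: bounded_measurableM => //.
  exact: continuous_bounded_measurable.
split => //; apply: bounded_measurable_int_continuous.
exact: continuous_bounded_measurable.
Qed.

Lemma integral_exprn (R : realType) (x : R) (n : nat) : 0 <= x ->
  \int[mu]_(t in `[0, x]) t ^+ n = x ^+ n.+1 / n.+1%:R.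
Proof.
rewrite le_eqVlt => /predU1P[<-|x0].
  by rewrite set_itv1 Rintegral_set1 expr0n mul0r.
have n1 : n.+1%:R != 0 :> R by rewrite pnatr_eq0.
have dF (y : R) : is_derive y 1 (fun t => t ^+ n.+1 / n.+1%:R) (y ^+ n).
  have dX : is_derive y 1 (fun t : R => t ^+ n.+1) (n.+1%:R * y ^+ n).
    have := @is_deriveX R R id n.+1 y 1 1 (is_derive_id _ _).
    rewrite /GRing.scale/= mulr1; congr (is_derive _ _ _ _).
    by apply/funext => t; rewrite exprfctE.
  have := is_deriveM dX (is_derive_cst (n.+1%:R^-1 : R) y 1).
  by rewrite scaler0 add0r /GRing.scale/= mulKf.
have cF (y : R) : {for y, continuous (fun t : R => t ^+ n.+1 / n.+1%:R)}.
  by have [dy _] := dF y; apply: differentiable_continuous; exact/derivable1_diffP.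
rewrite /Rintegral (@continuous_FTC2 _ _ (fun t : R => t ^+ n.+1 / n.+1%:R)) //.
- by rewrite /= expr0n mul0r subr0.
- by apply: continuous_subspaceT => y; exact: exprn_continuous.
- split.
  + by move=> y _; apply: ex_derive.
  + exact/cvg_at_right_filter/cF.
  + exact/cvg_at_left_filter/cF.
- by move=> y _; rewrite derive1E; apply: derive_val.
Qed.

Lemma Rintegral_le_exprn (R : realType) (f : R -> R) (K x : R) (n : nat) :
  bounded_measurable f -> 0 <= x -> x <= 1 ->
  (forall t, t \in `[0, x] -> `|f t| <= K * t ^+ n) ->
  `|\int[mu]_(t in `[0, x]) f t| <= K * (x ^+ n.+1 / n.+1%:R).
Proof.
move=> bf x0 x1 fK.
have intf := bounded_measurable_integrable bf x1.
have intX : mu.-integrable `[0, x] (EFin \o (fun t : R => t ^+ n)).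
  apply: bounded_measurable_integrable => //; apply: continuous_bounded_measurable.
  by apply: continuous_subspaceT => y; exact: exprn_continuous.
rewrite -integral_exprn// -RintegralZl//.
apply: le_trans (le_normr_Rintegral _ intf) _ => //.
apply: le_Rintegral => //.
- by apply: integrable_norm intf.
- by apply: (integrableZl _ K intX).
Qed.

(** Each step integrates [t ^ n] once more in [v], which produces the factorial;
    the second integration, in [u], does no harm since [x <= 1]. *)
Lemma string_coeff_le (R : realType) (p : R -> R) (a b M : R) (n : nat) :
  bounded_measurable p -> 0 <= M -> (forall x, x \in `[0, 1] -> `|p x| <= M) ->
  forall x, x \in `[0, 1] ->
  `|(string_coeff p a b n).1 x| <= (`|a| + `|b|) * M ^+ n / n`!%:R * x ^+ n /\
  `|(string_coeff p a b n).2 x| <= (`|a| + `|b|) * M ^+ n / n`!%:R * x ^+ n.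
Proof.
move=> bp M0 pM; elim: n => [|n IH] x x01.
  move: x01; rewrite in_itv/= => /andP[x0 x1].
  rewrite !expr0 mulr1 fact0 divr1 mulr1 lerDr normr_ge0; split => //.
  rewrite (le_trans (ler_normD _ _))// lerD2l normrM ler_piMr//.
  by rewrite ger0_norm.
set C := _ + _ in IH *.
have C0 : 0 <= C by rewrite addr_ge0.
pose K := C * M ^+ n.+1 / n.+1`!%:R.
have K0 : 0 <= K by rewrite divr_ge0// mulr_ge0// exprn_ge0.
have psi_le t : t \in `[0, 1] -> `|(string_coeff p a b n.+1).2 t| <= K * t ^+ n.+1.
  rewrite in_itv/= => /andP[t0 t1].
  have KE : K * t ^+ n.+1 = M * (C * M ^+ n / n`!%:R) * (t ^+ n.+1 / n.+1%:R).
    have n1 : n.+1%:R != 0 :> R by rewrite pnatr_eq0.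
    have nf : n`!%:R != 0 :> R by rewrite pnatr_eq0 -lt0n fact_gt0.
    rewrite /K factS natrM exprS.
    by move: (n.+1%:R : R) (n`!%:R : R) n1 nf => ? ? n1 nf; field; rewrite n1 nf.
  rewrite KE; apply: Rintegral_le_exprn => //.
    apply: bounded_measurableM => //; apply: continuous_bounded_measurable.
    exact: (string_coeff_continuous _ _ _ bp).1.
  move=> s s0t; have s01 : s \in `[0, 1] by exact: (subset_itv01 t1).
  rewrite normrM -mulrA ler_pM ?pM//.
  exact: (IH s s01).1.
split; last exact: psi_le.
move: x01; rewrite in_itv/= => /andP[x0 x1].
apply: (@le_trans _ _ (K * (x ^+ n.+2 / n.+2%:R))).
  apply: Rintegral_le_exprn => //.
    apply: continuous_bounded_measurable.
    exact: (string_coeff_continuous a b n.+1 bp).2.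
  by move=> s s0x; apply: psi_le; exact: (subset_itv01 x1).
rewrite ler_wpM2l// ler_pdivrMr// exprS mulrC ler_wpM2l ?exprn_ge0//.
by rewrite (le_trans x1)// ler1n.
Qed.

Lemma string_coeff_factorially_bounded (R : realType) (p : R -> R) (a b x : R) :
  bounded_measurable p -> x \in `[0, 1] ->
  factorially_bounded (fun n => (string_coeff p a b n).1 x) /\
  factorially_bounded (fun n => (string_coeff p a b n).2 x).
Proof.
move=> bp x01; have [_ [M M0 pM]] := bp.
have le1 n : (`|a| + `|b|) * M ^+ n / n`!%:R * x ^+ n <= (`|a| + `|b|) * M ^+ n / n`!%:R.
  move: x01; rewrite in_itv/= => /andP[x0 x1].
  by rewrite ler_piMr ?exprn_ile1// divr_ge0// mulr_ge0 ?addr_ge0 ?exprn_ge0.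
split; exists (`|a| + `|b|), M; split => //; rewrite ?addr_ge0// => n;
  apply: le_trans (le1 n); have [? ?] := string_coeff_le a b n bp M0 pM x01 => //.
Qed.

Lemma pseries_string_coeff_continuous (R : realType) (p : R -> R) (a b m : R) (n : nat) :
  bounded_measurable p ->
  {within `[0, 1], continuous (fun x => pseries (fun n => (string_coeff p a b n).1 x) m n)} /\
  {within `[0, 1], continuous (fun x => pseries (fun n => (string_coeff p a b n).2 x) m n)}.
Proof.
move=> bp; rewrite /pseries /series/=; elim: n => [|n [IH1 IH2]].
  split; apply: continuous_subspaceT => x.
    under [X in continuous_at _ X]eq_fun do rewrite big_geq//.
    exact: cvg_cst.
  under [X in continuous_at _ X]eq_fun do rewrite big_geq//.
  exact: cvg_cst.
have [c1 c2] := string_coeff_continuous a b n bp.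
have cm : {within `[0, 1], continuous (fun _ : R => m ^+ n)}.
  by apply: continuous_subspaceT => x; exact: cvg_cst.
split.
- under [X in {within _, continuous X}]eq_fun do rewrite big_nat_recr//=.
  by apply: continuous_withinD => //; exact: continuous_withinM.
- under [X in {within _, continuous X}]eq_fun do rewrite big_nat_recr//=.
  by apply: continuous_withinD => //; exact: continuous_withinM.
Qed.

(** The partial sums satisfy the integral equations up to a shift of the index, so
    the equations pass to the limit. *)
Lemma pseries_string_coeffE (R : realType) (p : R -> R) (a b m x : R) (n : nat) :
  bounded_measurable p -> 0 <= x -> x <= 1 ->
  let phi n x := pseries (fun k => (string_coeff p a b k).1 x) m n in
  let psi n x := pseries (fun k => (string_coeff p a b k).2 x) m n in
  phi n.+1 x = a + \int[mu]_(t in `[0, x]) psi n.+1 t /\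
  psi n.+1 x = b + m * \int[mu]_(t in `[0, x]) (p t * phi n t).
Proof.
move=> bp x0 x1 phi psi.
have phiS k y : phi k.+1 y = phi k y + (string_coeff p a b k).1 y * m ^+ k.
  by rewrite /phi /pseries /series/= big_nat_recr.
have psiS k y : psi k.+1 y = psi k y + (string_coeff p a b k).2 y * m ^+ k.
  by rewrite /psi /pseries /series/= big_nat_recr.
have phi0 y : phi 0 y = 0 by rewrite /phi /pseries /series/= big_geq.
have psi0 y : psi 0 y = 0 by rewrite /psi /pseries /series/= big_geq.
have b1 k : bounded_measurable (string_coeff p a b k).1.
  by apply: continuous_bounded_measurable; exact: (string_coeff_continuous a b k bp).1.
have b2 k : bounded_measurable (string_coeff p a b k).2.
  by apply: continuous_bounded_measurable; exact: (string_coeff_continuous a b k bp).2.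
have bphi k : bounded_measurable (phi k).
  apply: continuous_bounded_measurable; exact: (pseries_string_coeff_continuous a b m k bp).1.
have bpsi k : bounded_measurable (psi k).
  apply: continuous_bounded_measurable; exact: (pseries_string_coeff_continuous a b m k bp).2.
have intD (f g : R -> R) k : bounded_measurable f -> bounded_measurable g ->
    \int[mu]_(t in `[0, x]) (f t + g t * k) =
    \int[mu]_(t in `[0, x]) f t + (\int[mu]_(t in `[0, x]) g t) * k.
  move=> bf bg; have intf := bounded_measurable_integrable bf x1.
  have intg := bounded_measurable_integrable bg x1.
  rewrite RintegralD//; first by rewrite RintegralZr.
  exact: (bounded_measurable_integrable (bounded_measurableM bg (bounded_measurable_cst k))).
elim: n => [|n [IH1 IH2]]; split.
- rewrite phiS phi0 add0r expr0 mulr1/=; congr (_ + _).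
  under eq_Rintegral do rewrite psiS psi0 add0r expr0 mulr1/=.
  rewrite Rintegral_cst//; have := integral_exprn 0 x0.
  by under eq_Rintegral do rewrite expr0; rewrite Rintegral_cst// mul1r expr1 divr1 => ->.
- rewrite psiS psi0 add0r expr0 mulr1/=.
  under eq_Rintegral do rewrite phi0 mulr0.
  by rewrite Rintegral_cst// mul0r mulr0 addr0.
- rewrite phiS IH1.
  under [X in _ = _ + X]eq_Rintegral do rewrite psiS.
  by rewrite intD// addrA.
- rewrite psiS IH2.
  under [X in _ = _ + _ * X]eq_Rintegral do rewrite phiS mulrDr mulrA.
  rewrite intD//; try exact: bounded_measurableM.
  by rewrite mulrDr addrA exprS /=; congr (_ + _); rewrite mulrCA.
Qed.

Lemma bounded_measurable_cvg (R : realType) (f_ : nat -> R -> R) (f : R -> R) (K : R) :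
  (forall n, bounded_measurable (f_ n)) ->
  (forall n t, t \in `[0, 1] -> `|f_ n t| <= K) ->
  (forall t, t \in `[0, 1] -> f_ n t @[n --> \oo] --> f t) ->
  bounded_measurable f.
Proof.
move=> bf fK ff; split.
  apply: (@measurable_fun_cvg _ _ _ _ f_) => //; first by move=> n; case: (bf n).
exists `|K| => // t t01.
have : `|f_ n t| @[n --> \oo] --> `|f t| by apply: cvg_norm; exact: ff.
move=> /(@cvg_lim _ _ _) <- //.
apply: limr_le.
  by apply/cvg_ex; exists `|f t|; apply: cvg_norm; exact: ff.
by apply: nearW => n; apply: le_trans (fK n t t01) (ler_norm _).
Qed.

Lemma Rintegral_cvg (R : realType) (f_ : nat -> R -> R) (f : R -> R) (K x : R) :
  (forall n, bounded_measurable (f_ n)) ->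
  (forall n t, t \in `[0, 1] -> `|f_ n t| <= K) ->
  (forall t, t \in `[0, 1] -> f_ n t @[n --> \oo] --> f t) ->
  x <= 1 ->
  \int[mu]_(t in `[0, x]) f_ n t @[n --> \oo] --> \int[mu]_(t in `[0, x]) f t.
Proof.
move=> bf fK ff x1.
have bfl := bounded_measurable_cvg bf fK ff.
have intf := bounded_measurable_integrable bfl x1.
have intf_ n := bounded_measurable_integrable (bf n) x1.
have intK := bounded_measurable_integrable (bounded_measurable_cst K) x1.
have [] := @dominated_convergence _ _ _ mu `[0, x] _ (fun n t => (f_ n t)%:E)
  (fun t => (f t)%:E) (fun=> K%:E) => //.
- by move=> n; have /integrableP[] := intf_ n.
- by have /integrableP[] := intf.
- apply: aeW => t t0x; apply: cvg_EFin; first exact: nearW.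
  by apply: ff; exact: (subset_itv01 x1).
- by apply: aeW => t n t0x; rewrite /= lee_fin; apply: fK; exact: (subset_itv01 x1).
move=> _ _ cvgI.
apply: fine_cvg; rewrite fineK//; exact: integrable_fin_num.
Qed.

Definition string_u (R : realType) (p : R -> R) (a b m x : R) : R :=
  limn (pseries (fun n => (string_coeff p a b n).1 x) m).

Definition string_v (R : realType) (p : R -> R) (a b m x : R) : R :=
  limn (pseries (fun n => (string_coeff p a b n).2 x) m).

(** Dominated convergence, applied to the equations of the partial sums. *)
Lemma string_uvE (R : realType) (p : R -> R) (a b m : R) :
  bounded_measurable p ->
  [/\ bounded_measurable (string_u p a b m), bounded_measurable (string_v p a b m) &
  forall x, x \in `[0, 1] ->
    string_u p a b m x = a + \int[mu]_(t in `[0, x]) string_v p a b m t /\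
    string_v p a b m x = b + \int[mu]_(t in `[0, x]) (m * p t * string_u p a b m t)].
Proof.
move=> bp; have [_ [M M0 pM]] := bp.
pose phi n x := pseries (fun k => (string_coeff p a b k).1 x) m n.
pose psi n x := pseries (fun k => (string_coeff p a b k).2 x) m n.
pose K := (`|a| + `|b|) * expR (M * `|m|).
have phiK n t : t \in `[0, 1] -> `|phi n t| <= K.
  move=> t01; apply: pseries_le; rewrite ?addr_ge0// => k.
  have [+ _] := string_coeff_le a b k bp M0 pM t01; move/le_trans; apply.
  move: t01; rewrite in_itv/= => /andP[t0 t1].
  by rewrite ler_piMr ?exprn_ile1// divr_ge0// mulr_ge0 ?addr_ge0 ?exprn_ge0.
have psiK n t : t \in `[0, 1] -> `|psi n t| <= K.
  move=> t01; apply: pseries_le; rewrite ?addr_ge0// => k.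
  have [_] := string_coeff_le a b k bp M0 pM t01; move/le_trans; apply.
  move: t01; rewrite in_itv/= => /andP[t0 t1].
  by rewrite ler_piMr ?exprn_ile1// divr_ge0// mulr_ge0 ?addr_ge0 ?exprn_ge0.
have cphi t : t \in `[0, 1] -> phi n t @[n --> \oo] --> string_u p a b m t.
  by move=> t01; apply: factorially_bounded_cvg;
  exact: (string_coeff_factorially_bounded a b bp t01).1.
have cpsi t : t \in `[0, 1] -> psi n t @[n --> \oo] --> string_v p a b m t.
  by move=> t01; apply: factorially_bounded_cvg;
  exact: (string_coeff_factorially_bounded a b bp t01).2.
have bphi k : bounded_measurable (phi k).
  apply: continuous_bounded_measurable; exact: (pseries_string_coeff_continuous a b m k bp).1.
have bpsi k : bounded_measurable (psi k).
  apply: continuous_bounded_measurable; exact: (pseries_string_coeff_continuous a b m k bp).2.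
have bu := bounded_measurable_cvg bphi phiK cphi.
have bv := bounded_measurable_cvg bpsi psiK cpsi.
split => // x x01; move: (x01); rewrite in_itv/= => /andP[x0 x1].
have bpu := bounded_measurableM bp bu.
have bpphi n := bounded_measurableM bp (bphi n).
have pphiK n t : t \in `[0, 1] -> `|p t * phi n t| <= M * K.
  by move=> t01; rewrite normrM ler_pM ?pM ?phiK.
have cpphi t : t \in `[0, 1] -> p t * phi n t @[n --> \oo] --> p t * string_u p a b m t.
  by move=> t01; apply: cvgM; [exact: cvg_cst|exact: cphi].
split.
  have Iv := Rintegral_cvg bpsi psiK cpsi x1.
  apply: (@cvg_unique _ (@Rhausdorff R) (phi n.+1 x @[n --> \oo])).
    by move: (cphi x x01); rewrite -(cvg_shiftS (phi^~ x)).
  have -> : (fun n => phi n.+1 x) = (fun n => a + \int[mu]_(t in `[0, x]) psi n.+1 t).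
    by apply/funext => n; exact: (pseries_string_coeffE a b m n bp x0 x1).1.
  apply: cvgD; first exact: cvg_cst.
  by move: Iv; rewrite -(cvg_shiftS (fun n => \int[mu]_(t in `[0, x]) psi n t)).
have Iu := Rintegral_cvg bpphi pphiK cpphi x1.
under eq_Rintegral do rewrite -mulrA.
rewrite RintegralZl//; last exact: bounded_measurable_integrable.
apply: (@cvg_unique _ (@Rhausdorff R) (psi n.+1 x @[n --> \oo])).
  by move: (cpsi x x01); rewrite -(cvg_shiftS (psi^~ x)).
have -> : (fun n => psi n.+1 x) = (fun n => b + m * \int[mu]_(t in `[0, x]) (p t * phi n t)).
  by apply/funext => n; exact: (pseries_string_coeffE a b m n bp x0 x1).2.
by apply: cvgD; [exact: cvg_cst|apply: cvgM; [exact: cvg_cst|exact: Iu]].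
Qed.

(** * Eigenvalues and solutions of the string equation *)

Lemma primitive_string_uv (R : realType) (p : R -> R) (a b m : R) :
  density p ->
  [/\ primitive (string_u p a b m) (string_v p a b m),
      primitive (string_v p a b m) (fun x => m * p x * string_u p a b m x),
      string_u p a b m 0 = a & string_v p a b m 0 = b].
Proof.
move=> dp; have bp := density_bounded_measurable dp.
have [bu bv uvE] := string_uvE a b m bp.
have [] := uvE 0 (_ : 0 \in `[0, 1]); first by rewrite in_itv/= lexx ler01.
rewrite set_itv1 !Rintegral_set1 !addr0 => u0 v0.
split => //; split.
- exact: bounded_measurable_integrable.
- by move=> x x01; rewrite u0; have [] := uvE x x01.
- apply: bounded_measurable_integrable => //; apply: bounded_measurableM => //.
  by apply: bounded_measurableM => //; exact: bounded_measurable_cst.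
- by move=> x x01; rewrite v0; have [] := uvE x x01.
Qed.

Lemma string_uv1_continuous (R : realType) (p : R -> R) (a b : R) :
  density p ->
  continuous (fun m => string_u p a b m 1) /\ continuous (fun m => string_v p a b m 1).
Proof.
move=> dp; have bp := density_bounded_measurable dp.
have one01 : (1 : R) \in `[0, 1] by rewrite in_itv/= lexx ler01.
have [? ?] := string_coeff_factorially_bounded a b bp one01.
by split; exact: pseries_continuous.
Qed.

Lemma weighted_L2_real (R : realType) (p f : R -> R) :
  bounded_measurable p -> bounded_measurable f -> weighted_L2 p (fun x => (f x)%:C%C).
Proof.
move=> bp bf; split => //=.
- by case: bf.
- exact: bounded_measurable_integrable (bounded_measurableM (bounded_measurableD
    (bounded_measurableM bf bf) (bounded_measurable_cst (0 ^+ 2))) bp) (lexx 1).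
Qed.

Lemma cprimitive_real (R : realType) (F f : R -> R) :
  primitive F f -> cprimitive (fun x => (F x)%:C%C) (fun x => (f x)%:C%C).
Proof.
move=> Ff; split => //=; split.
  exact: bounded_measurable_integrable (bounded_measurable_cst 0) (lexx 1).
by move=> x _; rewrite Rintegral_cst// mul0r addr0.
Qed.

Lemma string_eigenvalue_of_primitive (R : realType) (p u v : R -> R) (alpha beta m : R) :
  density p -> primitive u v -> primitive v (fun x => m * p x * u x) ->
  u 0 * cos alpha + v 0 * sin alpha = 0 -> u 1 * cos beta + v 1 * sin beta = 0 ->
  (exists2 x, x \in `[0, 1] & u x != 0) ->
  string_eigenvalue p alpha beta (- m)%:C%C.
Proof.
move=> dp uv vw bc0 bc1 [x x01 ux0].
have bp := density_bounded_measurable dp.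
have bu := continuous_bounded_measurable (primitive_continuous uv).
exists (fun x => (u x)%:C%C); split.
  by exists x => //; apply: contra ux0 => /eqP[->].
split; first exact: weighted_L2_real.
split.
  under eq_fun do rewrite -rmorphM.
  by apply: weighted_L2_real => //; apply: bounded_measurableM => //; exact: bounded_measurable_cst.
exists (fun x => (v x)%:C%C), (fun x => (m * p x * u x)%:C%C); split.
- exact: cprimitive_real.
- exact: cprimitive_real.
- by apply: aeW => t _; rewrite -rmorphN -!rmorphM; congr (_%:C)%C; ring.
- by rewrite -!rmorphM -rmorphD/= bc0.
- by rewrite -!rmorphM -rmorphD/= bc1.
Qed.

(** For a real eigenvalue both the real and the imaginary part of an eigenfunction
    solve the problem, and one of them is nonzero. *)
Lemma string_eigenvalue_solution (R : realType) (p : R -> R) (alpha beta lambda : R) :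
  density p -> string_eigenvalue p alpha beta lambda%:C%C ->
  exists u v : R -> R, [/\ string_solution p (- lambda) u v,
    u 0 * cos alpha + v 0 * sin alpha = 0, u 1 * cos beta + v 1 * sin beta = 0 &
    exists2 x, x \in `[0, 1] & u x != 0].
Proof.
move=> dp [u [[x x01 ux0] [_ [_ [v [w [[ruv iuv] [rvw ivw] wE bc0 bc1]]]]]]].
have bp := density_bounded_measurable dp.
have bw (y z : R -> R) : primitive y z -> bounded_measurable (fun t => - lambda * p t * y t).
  move=> yz; apply: bounded_measurableM.
    by apply: bounded_measurableM => //; exact: bounded_measurable_cst.
  exact: continuous_bounded_measurable (primitive_continuous yz).
have [Rx|Rx] := eqVneq (complex.Re (u x)) 0.
- exists (fun t => complex.Im (u t)), (fun t => complex.Im (v t)); split.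
  + apply: primitive_string_solution => //.
    apply: primitive_ae ivw (bw _ _ iuv) _.
    move: wE; apply: filterS; first exact: (ae_filter_ringOfSetsType (@lebesgue_measure R)).
    move=> t wEt t01; have := congr1 (@complex.Im R) (wEt t01).
    by case: (w t) (u t) => [wr wi] [ur ui] /= H; lra.
  + move: bc0; case: (u 0) (v 0) => [ur ui] [vr vi] /(congr1 (@complex.Im R))/= H; lra.
  + move: bc1; case: (u 1) (v 1) => [ur ui] [vr vi] /(congr1 (@complex.Im R))/= H; lra.
  + exists x => //; apply: contra ux0; move: Rx.
    by case: (u x) => [ur ui] /= -> /eqP ->.
- exists (fun t => complex.Re (u t)), (fun t => complex.Re (v t)); split.
  + apply: primitive_string_solution => //.
    apply: primitive_ae rvw (bw _ _ ruv) _.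
    move: wE; apply: filterS; first exact: (ae_filter_ringOfSetsType (@lebesgue_measure R)).
    move=> t wEt t01; have := congr1 (@complex.Re R) (wEt t01).
    by case: (w t) (u t) => [wr wi] [ur ui] /= H; lra.
  + move: bc0; case: (u 0) (v 0) => [ur ui] [vr vi] /(congr1 (@complex.Re R))/= H; lra.
  + move: bc1; case: (u 1) (v 1) => [ur ui] [vr vi] /(congr1 (@complex.Re R))/= H; lra.
  + by exists x.
Qed.

(** * The shooting function *)

Lemma lim_pseries_at0 (R : realType) (c : nat -> R) : limn (pseries c 0) = c 0%N.
Proof.
apply/cvg_lim => //; rewrite -cvg_shiftS.
suff -> : (fun n => pseries c 0 n.+1) = (fun=> c 0%N) by exact: cvg_cst.
apply/funext => n; rewrite /pseries /series/= big_nat_recl// expr0 mulr1.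
by rewrite big1 ?addr0// => i _; rewrite expr0n mulr0.
Qed.

Lemma string_uv_mu0 (R : realType) (p : R -> R) (a b x : R) :
  string_u p a b 0 x = a + b * x /\ string_v p a b 0 x = b.
Proof. by rewrite /string_u /string_v !lim_pseries_at0. Qed.

Lemma antiderivative_off_const (R : realType) (s : seq R) (F f : R -> R) (x : R) :
  antiderivative_off s 0 1 F f -> (forall y, y \in `[0, 1] -> f y = 0) ->
  x \in `[0, 1] -> F x = F 0.
Proof.
move=> dF f0; rewrite in_itv/= => /andP[x0 x1].
have dFx := antiderivative_offS (lexx 0) x1 dF.
have f0' y : y \in `]0, x[ -> f y = 0.
  rewrite in_itv/= => /andP[y0 yx]; apply: f0.
  by rewrite in_itv/= !ltW// (lt_le_trans yx).
apply/eqP; rewrite eq_le; apply/andP; split.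
  rewrite -lerN2; apply: (antiderivative_off_le x0 (antiderivative_offN dFx)).
  by move=> y y0x _; rewrite f0' ?oppr0.
by apply: (antiderivative_off_le x0 dFx) => y y0x _; rewrite f0'.
Qed.

Lemma string_solution_mu0 (R : realType) (p u v : R -> R) (x : R) :
  string_solution p 0 u v -> x \in `[0, 1] ->
  u x = u 0 + v 0 * x /\ v x = v 0.
Proof.
move=> [s [du dv]] x01.
have vE y : y \in `[0, 1] -> v y = v 0.
  by apply: (antiderivative_off_const dv) => z _; rewrite !mul0r.
split; last exact: vE.
have dl := antiderivative_offD du (antiderivative_offM (antiderivative_off_cst s 0 1 (- v 0))
  (antiderivative_off_id s 0 1)).
have := antiderivative_off_const dl _ x01; rewrite /= mulr0 addr0 => <-; first ring.
by move=> y y01; rewrite vE//; ring.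
Qed.

(** The initial value [(sin alpha, - cos alpha)] satisfies the condition at [0]; the
    zeros of this function of [m] are those for which the condition at [1] holds
    too. *)
Definition string_shooting (R : realType) (p : R -> R) (alpha beta m : R) : R :=
  string_u p (sin alpha) (- cos alpha) m 1 * cos beta +
  string_v p (sin alpha) (- cos alpha) m 1 * sin beta.

Lemma string_shooting0 (R : realType) (p : R -> R) (alpha beta : R) :
  string_shooting p alpha beta 0 =
  - (cos alpha * cos beta - sin (alpha - beta)).
Proof.
rewrite /string_shooting sinB.
have [-> ->] := string_uv_mu0 p (sin alpha) (- cos alpha) 1; ring.
Qed.

Lemma string_shooting_eigenvalue (R : realType) (p : R -> R) (alpha beta m : R) :
  density p -> 0 <= m -> string_shooting p alpha beta m = 0 ->
  string_eigenvalue p alpha beta (- m)%:C%C.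
Proof.
move=> dp m0 D0.
have [uv vw u0 v0] := primitive_string_uv (sin alpha) (- cos alpha) m dp.
apply: (string_eigenvalue_of_primitive dp uv vw) => //.
  by rewrite u0 v0; ring.
apply: contrapT => uz.
have u_0 x : x \in `[0, 1] -> string_u p (sin alpha) (- cos alpha) m x = 0.
  by move=> x01; apply/eqP/negPn/negP => ux; apply: uz; exists x.
have v_0 := string_solution_v_eq0 dp m0 (primitive_string_solution dp uv vw)
  (lexx 0) ltr01 (lexx 1) u_0.
have zero01 : (0 : R) \in `[0, 1] by rewrite in_itv/= lexx ler01.
move: u0 v0; rewrite u_0// v_0// => sa /eqP; rewrite eq_sym oppr_eq0 => /eqP ca.
have := cos2Dsin2 alpha; rewrite ca -sa expr0n addr0 => /esym/eqP.
by rewrite oner_eq0.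
Qed.

(** The Riccati slope starts at [k = |b| / a], which makes [a b + k a ^ 2]
    nonnegative; for [a = 0] the quotient is [0], the admissible slope there. *)
Lemma string_solution_eventually_growing (R : realType) (p : R -> R) (a b l : R) :
  density p -> 0 <= l -> 0 <= a -> (a = 0 -> 0 < b) ->
  exists M, forall m, M <= m -> 0 < string_u p a b m 1 /\
    l * string_u p a b m 1 <= string_v p a b m 1.
Proof.
move=> dp l0 a0 b0; have [_ _ [c c0 cp]] := dp.
pose k := `|b| / a.
have k0 : 0 <= k by rewrite divr_ge0.
exists (((k + l) ^+ 2 + (k + l) + 1) / c) => m; rewrite ler_pdivrMr// => mc.
have [uv vw u0 v0] := primitive_string_uv a b m dp.
have := string_solution_growth dp c0 cp k0 l0 mc (primitive_string_solution dp uv vw).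
rewrite u0 v0; apply.
  move: a0; rewrite le_eqVlt => /predU1P[a0|]; [right|by left].
  by split => //; [rewrite /k -a0 invr0 mulr0|exact: b0].
have [->|an0] := eqVneq a 0; first by rewrite expr0n mul0r mulr0 addr0.
have -> : a * b + k * a ^+ 2 = a * (b + `|b|) by rewrite /k; field.
by rewrite mulr_ge0// -lerBlDl sub0r -normrN ler_norm.
Qed.

(** The shooting function is positive for large [m]: choosing
    [l = (|cos beta| + 1) / sin beta] in the growth estimate lets [v 1 sin beta]
    dominate [u 1 cos beta], while for [sin beta = 0] only [u 1 > 0] matters. *)
Lemma string_shooting_root (R : realType) (p : R -> R) (alpha beta m1 : R) :
  density p -> alpha \in `]0, pi] -> beta \in `[0, pi[ ->
  string_shooting p alpha beta m1 <= 0 ->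
  exists2 m, m1 <= m & string_shooting p alpha beta m = 0.
Proof.
move=> dp; rewrite !in_itv/= => /andP[alpha0 alphapi] /andP[beta0 betapi] D1.
have sa0 : 0 <= sin alpha by rewrite sin_ge0_pi// (ltW alpha0).
have sa_eq0 : sin alpha = 0 -> 0 < - cos alpha.
  move: alphapi; rewrite le_eqVlt => /predU1P[->|alphapi].
    by rewrite cospi opprK.
  by have := @sin_gt0_pi R alpha; rewrite alpha0 alphapi => /(_ isT) /[swap] ->; rewrite ltxx.
pose l := (`|cos beta| + 1) / sin beta.
have sb0 : 0 <= sin beta by rewrite sin_ge0_pi// beta0 ltW.
have l0 : 0 <= l by rewrite divr_ge0// addr_ge0.
have [M HM] := string_solution_eventually_growing dp l0 sa0 sa_eq0.
pose M1 := Num.max m1 M.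
have m1M : m1 <= M1 by rewrite le_max lexx.
have [|u1 uv1] := HM M1; first by rewrite le_max lexx orbT.
have DM : 0 < string_shooting p alpha beta M1.
  rewrite /string_shooting.
  set u := string_u _ _ _ _ _ in u1 uv1 *; set v := string_v _ _ _ _ _ in uv1 *.
  move: (sb0); rewrite le_eqVlt => /predU1P[sb|sb].
    suff -> : cos beta = 1 by rewrite -sb mulr0 addr0 mulr1.
    move: beta0; rewrite le_eqVlt => /predU1P[<-|beta0]; first by rewrite cos0.
    by have := @sin_gt0_pi R beta; rewrite beta0 betapi -sb ltxx => /(_ isT).
  have : l * u * sin beta <= v * sin beta by rewrite ler_wpM2r.
  have -> : l * u * sin beta = u * (`|cos beta| + 1).
    by rewrite /l; field; rewrite gt_eqF.
  have : 0 < u * (cos beta + `|cos beta| + 1).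
    by rewrite mulr_gt0// ltr_wpDl// -lerBlDl sub0r -normrN ler_norm.
  lra.
have cD : {within `[m1, M1], continuous (string_shooting p alpha beta)}.
  apply: continuous_subspaceT => m.
  have [cu cv] := string_uv1_continuous (sin alpha) (- cos alpha) dp.
  by apply: cvgD; apply: cvgM; [exact: cu|exact: cvg_cst|exact: cv|exact: cvg_cst].
have [m] := continuous_within_zero m1M cD (mulr_le0_ge0 D1 (ltW DM)).
by rewrite in_itv/= => /andP[m1m _] Dm; exists m.
Qed.

(** The parameter is one for which [u] vanishes at [1]; it exists because [u 1]
    equals [sin alpha - cos alpha < 0] at [m = 0] and is positive for large [m]. *)
Lemma string_shooting_le0 (R : realType) (p : R -> R) (alpha beta : R) :
  density p -> 0 < sin alpha -> sin alpha < cos alpha -> 0 <= sin beta ->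
  exists2 m, 0 < m & string_shooting p alpha beta m <= 0.
Proof.
move=> dp sa0 saca sb0.
have [M HM] := @string_solution_eventually_growing _ p (sin alpha) (- cos alpha) 0
  dp (lexx 0) (ltW sa0) (fun e => ltac:(by rewrite e ltxx in sa0)).
pose M1 := Num.max 0 M.
have M0 : 0 <= M1 by rewrite le_max lexx.
have [|u1 _] := HM M1; first by rewrite le_max lexx orbT.
have [cu _] := string_uv1_continuous (sin alpha) (- cos alpha) dp.
have [u10 _] := string_uv_mu0 p (sin alpha) (- cos alpha) 1.
have u0M : string_u p (sin alpha) (- cos alpha) 0 1 *
    string_u p (sin alpha) (- cos alpha) M1 1 <= 0.
  by rewrite mulr_le0_ge0 ?(ltW u1)// u10; lra.
have [m] := continuous_within_zero M0 (continuous_subspaceT cu) u0M.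
rewrite in_itv/= le_eqVlt => /andP[/predU1P[<- _|m0 _ um]].
  by rewrite u10 => h; exfalso; lra.
exists m => //; rewrite /string_shooting um mul0r add0r mulr_le0_ge0//.
have [uv vw u0 v0] := primitive_string_uv (sin alpha) (- cos alpha) m dp.
have sol := primitive_string_solution dp uv vw.
by apply: (string_solution_first_zero dp (ltW m0) sol); rewrite ?u0.
Qed.

(** * Signs of the eigenvalues *)

Lemma sin_pi4 (R : realType) : sin (pi / 4) = cos (pi / 4) :> R.
Proof.
rewrite -cosN -sinDpihalf; congr sin; lra.
Qed.

Lemma cos_pi4_gt0 (R : realType) : 0 < cos (pi / 4) :> R.
Proof. by rewrite cos_gt0_pihalf//; have := pi_gt0 R; lra. Qed.

Lemma sinBpi4 (R : realType) (x : R) : sin (x - pi / 4) = cos (pi / 4) * (sin x - cos x).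
Proof. by rewrite sinB sin_pi4; ring. Qed.

Lemma sinDpi4 (R : realType) (x : R) : sin (x + pi / 4) = cos (pi / 4) * (sin x + cos x).
Proof. by rewrite sinD sin_pi4; ring. Qed.

Lemma string_form_le (R : realType) (u v : R -> R) (alpha beta : R) :
  alpha \in `[pi / 4, pi] -> beta \in `[0, 3 * pi / 4] ->
  cos alpha * cos beta - sin (alpha - beta) <= 0 ->
  u 0 * cos alpha + v 0 * sin alpha = 0 -> u 1 * cos beta + v 1 * sin beta = 0 ->
  u 1 * v 1 - u 0 * v 0 <= (u 1 - u 0) ^+ 2.
Proof.
rewrite !in_itv/= => /andP[al0 al1] /andP[be0 be1]; rewrite sinB => D.
have pi0 := pi_gt0 R; have h0 := cos_pi4_gt0 R.
have sq x : sin x ^+ 2 + cos x ^+ 2 = 1 :> R by rewrite addrC cos2Dsin2.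
apply: boundary_form_le (sq alpha) (sq beta) _ _ _ _ D.
- by apply: sin_ge0_pi; lra.
- by apply: sin_ge0_pi; lra.
- by rewrite -(pmulr_rge0 _ h0) -sinBpi4; apply: sin_ge0_pi; lra.
- by rewrite -(pmulr_rge0 _ h0) -sinDpi4; apply: sin_ge0_pi; lra.
Qed.

Lemma string_eigenvalue_ge0 (R : realType) (p : R -> R) (alpha beta lambda : R) :
  density p -> alpha \in `[pi / 4, pi] -> beta \in `[0, 3 * pi / 4] ->
  cos alpha * cos beta - sin (alpha - beta) <= 0 ->
  string_eigenvalue p alpha beta lambda%:C%C -> 0 <= lambda.
Proof.
move=> dp al be D /(string_eigenvalue_solution dp)[u [v [sol bc0 bc1 unz]]].
rewrite leNgt; apply/negP => l0.
have ml0 : 0 < - lambda by rewrite oppr_gt0.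
have := energy_gt dp ml0 sol unz.
by rewrite ltNge (string_form_le al be D bc0 bc1).
Qed.

(** The eigenfunctions would be affine, with [(u 0, v 0) = r (sin alpha, - cos alpha)],
    and the condition at [1] reads [- r Delta = 0]. *)
Lemma string_eigenvalue_neq0 (R : realType) (p : R -> R) (alpha beta : R) :
  density p -> cos alpha * cos beta - sin (alpha - beta) != 0 ->
  ~ string_eigenvalue p alpha beta (0 : R)%:C%C.
Proof.
move=> dp D /(string_eigenvalue_solution dp)[u [v [sol bc0 bc1 [x x01]]]].
rewrite oppr0 in sol; have uE := string_solution_mu0 sol.
have one01 : (1 : R) \in `[0, 1] by rewrite in_itv/= lexx ler01.
have [u1 v1] := uE 1 one01; rewrite u1 v1 mulr1 in bc1.
pose r := u 0 * sin alpha - v 0 * cos alpha.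
have cs := cos2Dsin2 alpha.
have u0 : u 0 = r * sin alpha.
  have -> : u 0 = u 0 * (cos alpha ^+ 2 + sin alpha ^+ 2) by rewrite cs mulr1.
  have -> : u 0 * (cos alpha ^+ 2 + sin alpha ^+ 2) = r * sin alpha +
     (u 0 * cos alpha + v 0 * sin alpha) * cos alpha by rewrite /r; ring.
  by rewrite bc0 mul0r addr0.
have v0 : v 0 = - r * cos alpha.
  have -> : v 0 = v 0 * (cos alpha ^+ 2 + sin alpha ^+ 2) by rewrite cs mulr1.
  have -> : v 0 * (cos alpha ^+ 2 + sin alpha ^+ 2) = - r * cos alpha +
     (u 0 * cos alpha + v 0 * sin alpha) * sin alpha by rewrite /r; ring.
  by rewrite bc0 mul0r addr0.
have : - r * (cos alpha * cos beta - sin (alpha - beta)) = 0.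
  by rewrite -bc1 u0 v0 sinB; ring.
move/eqP; rewrite mulf_eq0 oppr_eq0 (negbTE D) orbF => /eqP r0.
by have [-> _] := uE x x01; rewrite u0 v0 r0 oppr0 !mul0r addr0 eqxx.
Qed.

(** When the starting parameter is [0], the root found above it is positive because
    the shooting function does not vanish at [0]. *)
Lemma string_eigenvalue_lt0 (R : realType) (p : R -> R) (alpha beta : R) :
  density p -> alpha \in `]0, pi] -> beta \in `[0, pi[ ->
  alpha < pi / 4 \/ 0 < cos alpha * cos beta - sin (alpha - beta) ->
  exists2 m, 0 < m & string_eigenvalue p alpha beta (- m)%:C%C.
Proof.
move=> dp al be h.
have [m1 [m10 D1]] : exists m1, (0 < m1 \/ 0 <= m1 /\ string_shooting p alpha beta 0 != 0) /\
    string_shooting p alpha beta m1 <= 0.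
  case: h => [al4|D0]; last first.
    exists 0; split; last by rewrite string_shooting0 oppr_le0 ltW.
    by right; rewrite string_shooting0 oppr_eq0 gt_eqF.
  move: (al) (be); rewrite !in_itv/= => /andP[al0 _] /andP[be0 be1].
  have pi0 := pi_gt0 R; have h0 := cos_pi4_gt0 R.
  have sa : 0 < sin alpha by apply: sin_gt0_pi; lra.
  have sb : 0 <= sin beta by apply: sin_ge0_pi; rewrite be0 ltW.
  have saca : sin alpha < cos alpha.
    rewrite -subr_gt0 -(pmulr_rgt0 _ h0) -opprB mulrN -sinBpi4 -sinN.
    by apply: sin_gt0_pi; lra.
  by have [m m0 Dm] := string_shooting_le0 dp sa saca sb; exists m; split; [left|].
have [m m1m Dm] := string_shooting_root dp al be D1.
have m0 : 0 < m.
  case: m10 => [m10|[m10 D0]]; first exact: lt_le_trans m1m.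
  rewrite lt_neqAle (le_trans m10 m1m) andbT.
  by apply: contraNneq D0 => m_eq0; move: Dm; rewrite -m_eq0 => ->.
by exists m => //; apply: string_shooting_eigenvalue => //; exact: ltW.
Qed.

Theorem theorem3p3 (R : realType) (p : R -> R) (alpha beta lambda0 : R)
    (hp : density p) (halpha : alpha \in `]0, pi]) (hbeta : beta \in `[0, pi[)
    (hlambda0 : lowest_eigenvalue p alpha beta lambda0) :
  let Delta := cos alpha * cos beta - sin (alpha - beta) in
  let case_i := [/\ alpha \in `[pi / 4, pi], beta \in `[0, 3 * pi / 4]
                  & Delta = 0] in
  let case_ii := [/\ alpha \in `]pi / 4, pi], beta \in `[0, 3 * pi / 4[
                   & Delta < 0] in
  [/\ case_i -> lambda0 = 0,
      case_ii -> 0 < lambda0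
    & ~ case_i -> ~ case_ii -> lambda0 < 0].
Proof.
move=> Delta case_i case_ii.
have [eig0 min0] := hlambda0.
split.
- move=> [al be D0]; apply/eqP; rewrite eq_le; apply/andP; split.
    rewrite -oppr0; apply: min0; apply: string_shooting_eigenvalue => //.
    by rewrite string_shooting0 -/Delta D0 oppr0.
  by apply: (string_eigenvalue_ge0 hp al be) eig0; rewrite -/Delta D0.
- move=> [al be D0]; rewrite lt_neqAle; apply/andP; split.
    apply/eqP => l0; apply: (@string_eigenvalue_neq0 _ p alpha beta hp); first by rewrite lt_eqF.
    by rewrite l0.
  have al' : alpha \in `[pi / 4, pi].
    by move: al; rewrite !in_itv/= => /andP[/ltW -> ->].
  have be' : beta \in `[0, 3 * pi / 4].
    by move: be; rewrite !in_itv/= => /andP[-> /ltW ->].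
  by apply: (string_eigenvalue_ge0 hp al' be') eig0; rewrite ltW.
- move=> ni nii.
  suff h : alpha < pi / 4 \/ 0 < Delta.
    have [m m0 eigm] := string_eigenvalue_lt0 hp halpha hbeta h.
    by apply: le_lt_trans (min0 _ eigm) _; rewrite oppr_lt0.
  have [al4|al4] := ltP alpha (pi / 4); [by left|right].
  move: (halpha) (hbeta); rewrite !in_itv/= => /andP[al0 al1] /andP[be0 be1].
  have pi0 := pi_gt0 R; have h0 := cos_pi4_gt0 R.
  have sa : 0 <= sin alpha by apply: sin_ge0_pi; rewrite al1 ltW.
  have sb : 0 <= sin beta by apply: sin_ge0_pi; rewrite be0 ltW.
  have saca : 0 <= sin alpha - cos alpha.
    by rewrite -(pmulr_rge0 _ h0) -sinBpi4; apply: sin_ge0_pi; lra.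
  have DE : Delta = sin alpha * sin beta - (sin beta + cos beta) * (sin alpha - cos alpha).
    by rewrite /Delta sinB; ring.
  have [be4|be4] := leP beta (3 * pi / 4).
    have al : alpha \in `[pi / 4, pi] by rewrite in_itv/= al4.
    have be : beta \in `[0, 3 * pi / 4] by rewrite in_itv/= be0.
    rewrite lt_neqAle; apply/andP; split.
      by apply/eqP => D0; apply: ni.
    rewrite leNgt; apply/negP => D0; apply: nii; split => //; rewrite in_itv/=.
    + rewrite al1 andbT lt_neqAle al4 andbT; apply: contraTneq D0 => al_eq.
      rewrite -leNgt DE; have -> : sin alpha - cos alpha = 0.
        by rewrite -al_eq sin_pi4 subrr.
      by rewrite mulr0 subr0 mulr_ge0.
    + rewrite be0/= lt_neqAle be4 andbT; apply: contraTneq D0 => be_eq.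
      rewrite -leNgt DE; have -> : sin beta + cos beta = 0.
        apply/eqP; rewrite -(mulrI_eq0 _ (lregP (lt0r_neq0 h0))) -sinDpi4.
        have -> : beta + pi / 4 = pi by rewrite be_eq; lra.
        by rewrite sinpi.
      by rewrite mul0r subr0 mulr_ge0.
  have sbcb : sin beta + cos beta < 0.
    rewrite -(pmulr_rlt0 _ h0) -sinDpi4.
    have -> : beta + pi / 4 = (beta - 3 * pi / 4) + pi by lra.
    by rewrite sinDpi oppr_lt0; apply: sin_gt0_pi; lra.
  have sb' : 0 < sin beta by apply: sin_gt0_pi; lra.
  rewrite DE; move: sa; rewrite le_eqVlt => /predU1P[sa|sa].
    have alpi : alpha = pi.
      apply/eqP; rewrite eq_le al1 leNgt; apply/negP => al1'.
      by have := @sin_gt0_pi R alpha; rewrite al0 al1' -sa ltxx => /(_ isT).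
    by rewrite alpi sinpi cospi; lra.
  by rewrite subr_gt0 (@le_lt_trans _ _ 0) ?mulr_gt0// mulr_le0_ge0// ltW.
Qed.
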